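(* For each $n\ge 2$ let $\underline R(2,n)$ denote the rank of a generic skew-symmetric tensor $\omega\in\wedge^{3}\mathbb{C}^{n+1}$ (the typical rank). Then $\underline R(2,n)\sim \frac{n^2}{18}$ as $n\to\infty$, i.e. $$\lim_{n\to\infty}\frac{\underline R(2,n)}{n^2/18}=1.$$
   Context: An element $\omega\in\wedge^{3}\mathbb{C}^{n+1}$ has rank $r$ if it can be written as a sum $\omega=\sum_{t=1}^r v_{1,t}\wedge v_{2,t}\wedge v_{3,t}$ of $r$ decomposable skew-symmetric tensors ($v_{i,t}\in\mathbb{C}^{n+1}$) but not fewer. The typical rank $\underline R(2,n)$ is the least integer $s$ such that a generic element (i.e. every element of some nonempty Zariski open subset) of $\wedge^{3}\mathbb{C}^{n+1}$ has rank at most $s$. Equivalently, it is the least $s$ such that $\sigma_s(Gr(2,n))=\mathbb{P}(\wedge^3\mathbb{C}^{n+1})$, where $Gr(2,n)\subset\mathbb{P}(\wedge^3\mathbb{C}^{n+1})$ is the Plücker-embedded Grassmannian of $3$-dimensional linear subspaces of $\mathbb{C}^{n+1}$ and $\sigma_s(X)$ is the Zariski closure of the union of the linear spans of $s$-tuples of points of $X$. *)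

(* Defs.v *)
From HB Require Import structures.
From mathcomp Require Import all_boot all_order all_algebra all_fingroup.
From mathcomp Require Import boolp classical_sets.
From mathcomp Require mpoly.
Set Implicit Arguments.
Unset Strict Implicit.
Unset Printing Implicit Defensive.
Import Order.TTheory GRing.Theory Num.Theory.
Local Open Scope ring_scope.

(* The exterior power wedge^3 F^m, in characteristic 0, is realised as the
   space of skew-symmetric tensors in (F^m)^{(x)3}; the tensor t has
   coordinates t i, where i = (i_0, i_1, i_2) is a triple of indices. *)

Notation triple m := {ffun 'I_3 -> 'I_m}.

Definition perm_triple (m : nat) (i : triple m) (s : 'S_3) : triple m :=
  [ffun a => i (s a)].

Definition skew_symmetric (F : numFieldType) (m : nat) :
    {pred {ffun triple m -> F}} :=
  fun t => [forall i, forall s : 'S_3,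
    t (perm_triple i s) == (-1) ^+ s * t i].

Lemma skew_symmetric_zmod_closed (F : numFieldType) (m : nat) :
  zmod_closed (@skew_symmetric F m).
Proof.
split=> [|t u /forallP ht /forallP hu].
  by apply/forallP=> i; apply/forallP=> s; rewrite !ffunE mulr0.
apply/forallP=> i; apply/forallP=> s.
rewrite !ffunE mulrBr.
by rewrite (eqP (forallP (ht i) s)) (eqP (forallP (hu i) s)).
Qed.

HB.instance Definition _ (F : numFieldType) (m : nat) :=
  GRing.isZmodClosed.Build {ffun triple m -> F} (@skew_symmetric F m)
    (@skew_symmetric_zmod_closed F m).

Record wedge3 (F : numFieldType) (m : nat) := Wedge3 {
  tensor_of :> {ffun triple m -> F};
  _ : tensor_of \in @skew_symmetric F m
}.

HB.instance Definition _ (F : numFieldType) (m : nat) :=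
  [isSub for @tensor_of F m].
HB.instance Definition _ (F : numFieldType) (m : nat) :=
  [Choice of wedge3 F m by <:].
HB.instance Definition _ (F : numFieldType) (m : nat) :=
  [SubChoice_isSubZmodule of wedge3 F m by <:].

(* v_0 /\ v_1 /\ v_2 = \sum_s sgn(s) v_(s 0) (x) v_(s 1) (x) v_(s 2), where
   v_0, v_1, v_2 are the rows of v: its coordinate at (i_0, i_1, i_2) is the
   minor of v on the columns i_0, i_1, i_2. *)
Definition minors_tensor (F : numFieldType) (m : nat) (v : 'M[F]_(3, m)) :
    {ffun triple m -> F} :=
  [ffun i : triple m => \det (colsub i v)].

Lemma minors_skew (F : numFieldType) (m : nat) (v : 'M[F]_(3, m)) :
  minors_tensor v \in @skew_symmetric F m.
Proof.
apply/forallP=> i; apply/forallP=> s; rewrite !ffunE.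
have -> : colsub (perm_triple i s) v
        = col_perm s (colsub i v).
  by apply/matrixP=> a b; rewrite !mxE ffunE.
by rewrite col_permE det_mulmx det_perm odd_permV mulrC.
Qed.

Definition decomposable (F : numFieldType) (m : nat) (v : 'M[F]_(3, m)) : wedge3 F m :=
  Wedge3 (minors_skew v).

Definition sum_of_decomposables (F : numFieldType) (m : nat)
    (w : wedge3 F m) (r : nat) : Prop :=
  exists v : 'I_r -> 'M[F]_(3, m), w = \sum_(t < r) decomposable (v t).

Lemma tensor_of_sum (F : numFieldType) (m : nat) (I : Type) (l : seq I)
    (f : I -> wedge3 F m) (j : triple m) :
  (\sum_(t <- l) f t) j = \sum_(t <- l) f t j.
Proof.
elim: l => [|a l IH]; first by rewrite !big_nil ffunE.
by rewrite !big_cons ffunE IH.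
Qed.

Lemma sum_of_decomposables_all (F : numFieldType) (m : nat) (w : wedge3 F m) :
  sum_of_decomposables w #|{: triple m}|.
Proof.
pose c (i : triple m) (a : 'I_3) : F := if a == 0 then w i / 6%:R else 1.
pose e (i : triple m) : 'M[F]_(3, m) :=
  \matrix_(a, b) (c i a * (i a == b)%:R).
exists (fun t => e (enum_val t)).
apply/val_inj/ffunP=> j /=.
rewrite tensor_of_sum.
rewrite -(big_enum_val (A := {: triple m}) (fun i => decomposable (e i) j)) /=.
transitivity (\sum_(s : 'S_3) w j / 6%:R).
  by rewrite sumr_const card_Sn -[LHS](divfK (_ : 6%:R != 0)) ?mulr_natr ?pnatr_eq0.
under [RHS]eq_bigr => i _ do rewrite ffunE.
rewrite /determinant exchange_big /=; apply: eq_bigr => s _.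
have skw : w (perm_triple j s) = (-1) ^+ s * w j.
  by have /forallP/(_ j)/forallP/(_ s)/eqP := valP w.
rewrite (bigD1 (perm_triple j s)) //= [X in _ + X]big1 ?addr0; last first.
  move=> i ne; have [a ia] : exists a, i a != j (s a).
    apply/existsP; apply: contraNT ne; rewrite negb_exists => /forallP h.
    by apply/eqP/ffunP=> a; rewrite ffunE; apply/eqP; have := h a; rewrite negbK.
  by rewrite (bigD1 a) //= !mxE (negPf ia) mulr0 mul0r mulr0.
rewrite big_ord_recl big1 => [|a _]; rewrite !mxE !ffunE eqxx !mulr1.
  by rewrite /c eqxx skw mulrA mulrA -expr2 sqrr_sign mul1r.
by rewrite /c.
Qed.

Lemma tensor_rank_exists (F : numFieldType) (m : nat) (w : wedge3 F m) :
  exists r, `[< sum_of_decomposables w r >].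
Proof. by exists #|{: triple m}|; apply/asboolP/sum_of_decomposables_all. Qed.

Definition tensor_rank (F : numFieldType) (m : nat) (w : wedge3 F m) : nat :=
  ex_minn (tensor_rank_exists w).

(* Polynomial functions on the linear subspace wedge3 of the tensor space are
   the restrictions of polynomials in all the tensor coordinates. *)
Definition eval_at (F : numFieldType) (m : nat)
    (p : mpoly.mpoly #|{: triple m}| F) (w : wedge3 F m) : F :=
  mpoly.meval (fun k => w (enum_val k)) p.

Definition zariski_closed (F : numFieldType) (m : nat)
    (Z : set (wedge3 F m)) : Prop :=
  exists I : set (mpoly.mpoly #|{: triple m}| F),
    Z = [set w | forall p, I p -> eval_at p w = 0]%classic.

Definition zariski_open (F : numFieldType) (m : nat)
    (U : set (wedge3 F m)) : Prop :=
  zariski_closed (~` U)%classic.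

Definition generic (F : numFieldType) (m : nat)
    (P : wedge3 F m -> Prop) : Prop :=
  exists U : set (wedge3 F m),
    [/\ zariski_open U, (U !=set0)%classic & forall w, U w -> P w].

Lemma typical_rank_exists (F : numFieldType) (n : nat) :
  exists s, `[< generic (fun w : wedge3 F n.+1 => (tensor_rank w <= s)%N) >].
Proof.
exists #|{: triple n.+1}|; apply/asboolP; exists setT; split.
- exists [set mpoly.mpolyC _ 1]%classic; rewrite setCT; apply/esym/seteqP; split=> // w /=.
  by move=> /(_ _ erefl)/eqP; rewrite /eval_at mpoly.mevalC oner_eq0.
- by exists 0.
- move=> w _; rewrite /tensor_rank; case: ex_minnP => r _; apply.
  exact/asboolP/sum_of_decomposables_all.
Qed.

(* n is the projective dimension: the tensors live in wedge^3 F^{n+1}. *)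
Definition typical_rank (F : numFieldType) (n : nat) : nat :=
  ex_minn (typical_rank_exists F n).

(* Main.v *)
Require Import Defs.
From mathcomp Require Import all_boot all_order all_algebra all_fingroup.
From mathcomp Require Import all_classical all_reals all_analysis.
From mathcomp Require Import complex closed_field.
From mathcomp Require Import -(notations) mpoly.
From mathcomp Require Import zify ring lra.
Set Implicit Arguments.
Unset Strict Implicit.
Unset Printing Implicit Defensive.
Import Order.TTheory GRing.Theory Num.Theory numFieldNormedType.Exports.
Local Open Scope ring_scope.

(** Write N = n + 1 and let T be the typical rank of alternating 3-tensors on
    an N-dimensional space.  Both bounds on T compare the 3N entries of a
    frame (three vectors) with the dimension of the space, about N^3/6; this
    quotient is N^2/18.

    Lower bound.  If 3Ns < C(N,3), the sums of s decomposable tensors satisfy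
    a nontrivial polynomial equation (parameter_count), so they miss a generic
    tensor; hence C(N,3) <= 3N T.

    Upper bound, reduction to linear algebra.  At a family of s frames, the
    differential of (frames) |-> (sum of their wedge products) is onto as soon
    as no nonzero alternating trilinear form phi satisfies phi(x,y,.) = 0 for
    all pairs x, y of vectors taken from one frame (tangents_span, a dual form
    of Terracini's lemma).  If the differential is onto at one point, no
    nonzero polynomial vanishes on the image (tangent_dominant).  Over an
    algebraically closed field, quantifier elimination describes the image by
    a quantifier-free formula; such a formula is constant on a nonempty open
    set, and if the constant were false the image would lie in a hypersurface
    (dominant_generic).  So T <= s.

    Upper bound, construction of the frames.  Decompose the space into k
    summands V_i of dimension 3r.  Few frames, O(k r^2), suffice to make phi
    vanish as soon as two arguments lie in the same V_i.  The other frames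
    have their three vectors in three different summands: there is one frame
    for each block {i,j,l} with i + j + l in a fixed set of 3r^2 + 3 residues
    modulo k, so at most k^2(3r^2+3)/6 frames in all, and every pair i, j lies in
    about 3r^2 blocks.  A triple i, j, l thus gives constraints
    phi(a,b,.) = 0 on V_i x V_j x V_l for 3r^2 pairs (a,b) in V_i x V_j, and
    likewise for the two other pairs of indices.  That these 3 * 3r^2 * 3r
    equations have only the solution 0 is an explicit check for r = 1
    (local_configuration_spans); the general case follows by cutting each
    V_i into r pieces of dimension 3 (locally_spanning_exists).  The vectors
    that serve one triple need not serve another, but each condition is an
    open one, so a single choice of vectors serves all triples
    (common_frames).

    With 3rk close to N, the number of frames is
    (1 + 1/r^2) N^2/18 + O(N) for fixed r, and r is arbitrary. *)

(** * A spanning configuration in dimension three *)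

Lemma ord3P (P : 'I_3 -> Prop) :
  P ord0 -> P (lift ord0 ord0) -> P (lift ord0 (lift ord0 ord0)) -> forall i, P i.
Proof.
move=> P0 P1 P2 i.
by case: (unliftP ord0 i) => [j|] -> //; case: (unliftP ord0 j) => [l|] -> //; rewrite (ord1 l).
Qed.

Section LocalConfiguration.
Variable F : comNzRingType.

(** Three pairs of vectors for each of the three pairs of factors in a
    trilinear form on a space of dimension 3; the pair number t for the
    factors 1, 2 is (left12 t, right12 t).  The vectors are sparse and
    make the 27 equations below triangular. *)
Definition left12 (t i : 'I_3) : F := (i == t)%:R.
Definition right12 (t i : 'I_3) : F := (i == t)%:R.
Definition left13 (t i : 'I_3) : F :=
  (nth [::] [:: [:: 1; -1; 0]; [:: 1; 0; -1]; [:: 0; 1; 1]] t)`_i.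
Definition right13 (t i : 'I_3) : F := (i == t)%:R.
Definition left23 (t i : 'I_3) : F :=
  (nth [::] [:: [:: 1; 1; 0]; [:: 0; 1; 1]; [:: 1; 0; -1]] t)`_i.
Definition right23 (t i : 'I_3) : F :=
  (nth [::] [:: [:: 1; -1; 0]; [:: 1; 0; 1]; [:: 0; 1; -1]] t)`_i.

(** There are 9 equations for each pair of factors, and 27 unknowns: the
    configuration wastes no equation, which is what makes the constant 1/18
    attainable.  Coordinate vectors alone cannot do this: a tripartite graph with
    3 vertices in each part and 3 edges between any two parts never meets all
    27 triples in an edge. *)
Lemma local_configuration_spans (p : 'I_3 -> 'I_3 -> 'I_3 -> F) :
  (forall t k, \sum_i \sum_j left12 t i * right12 t j * p i j k = 0) ->
  (forall t j, \sum_i \sum_k left13 t i * right13 t k * p i j k = 0) ->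
  (forall t i, \sum_j \sum_k left23 t j * right23 t k * p i j k = 0) ->
  forall i j k, p i j k = 0.
Proof.
move=> h12 h13 h23.
pose e0 := @ord0 2; pose e1 := lift e0 (@ord0 1).
pose e2 := lift e0 (lift (@ord0 1) (@ord0 0)).
have sum3 (f : 'I_3 -> F) : \sum_i f i = f e0 + f e1 + f e2.
  by rewrite !big_ord_recl big_ord0 addr0 addrA.
have z12 t k : p t t k = 0.
  rewrite -(h12 t k) (bigD1 t) //= (bigD1 t) //= /left12 /right12 eqxx !mul1r.
  rewrite [X in _ + X + _]big1 => [|j /negPf ->]; last by rewrite ?mulr0 ?mul0r.
  rewrite [X in _ + X]big1 ?addr0 // => i /negPf hi.
  by rewrite big1 // => j _; rewrite hi !mul0r.
have a0 j : p e0 j e0 = p e1 j e0.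
  have := h13 e0 j; rewrite !sum3 /left13 /right13 /= !(mul0r, mulr0, mul1r, mulr1, add0r, addr0).
  by rewrite mulN1r => /eqP; rewrite subr_eq0 => /eqP.
have a1 j : p e0 j e1 = p e2 j e1.
  have := h13 e1 j; rewrite !sum3 /left13 /right13 /= !(mul0r, mulr0, mul1r, mulr1, add0r, addr0).
  by rewrite mulN1r => /eqP; rewrite subr_eq0 => /eqP.
have a2 j : p e1 j e2 = - p e2 j e2.
  have := h13 e2 j; rewrite !sum3 /left13 /right13 /= !(mul0r, mulr0, mul1r, mulr1, add0r, addr0).
  by move=> /eqP; rewrite addr_eq0 => /eqP.
have b0 i : p i e0 e0 - p i e0 e1 + (p i e1 e0 - p i e1 e1) = 0.
  have := h23 e0 i; rewrite !sum3 /left23 /right23 /= !(mul0r, mulr0, mul1r, mulr1, add0r, addr0).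
  by rewrite !mulN1r.
have b1 i : p i e1 e0 + p i e1 e2 + (p i e2 e0 + p i e2 e2) = 0.
  have := h23 e1 i; rewrite !sum3 /left23 /right23 /= !(mul0r, mulr0, mul1r, mulr1, add0r, addr0).
  by [].
have b2 i : p i e0 e1 - p i e0 e2 + (- p i e2 e1 + p i e2 e2) = 0.
  have := h23 e2 i; rewrite !sum3 /left23 /right23 /= !(mul0r, mulr0, mul1r, mulr1, add0r, addr0).
  by rewrite ?mulrNN ?mulN1r ?mul1r.
(* Each equation is now solved in an order where one unknown remains. *)
have p100 : p e1 e0 e0 = 0 by rewrite -a0.
have p010 : p e0 e1 e0 = 0 by rewrite a0.
have p201 : p e2 e0 e1 = 0 by rewrite -a1.
have p021 : p e0 e2 e1 = 0 by rewrite a1.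
have p212 : p e2 e1 e2 = 0 by apply: oppr_inj; rewrite -a2 z12 oppr0.
have p122 : p e1 e2 e2 = 0 by rewrite a2 z12 oppr0.
have p011 : p e0 e1 e1 = 0.
  by have := b0 e0; rewrite !z12 p010 !(subr0, sub0r, add0r) => /eqP; rewrite oppr_eq0 => /eqP.
have p211 : p e2 e1 e1 = 0 by rewrite -a1.
have p101 : p e1 e0 e1 = 0.
  by have := b0 e1; rewrite !z12 p100 !(subr0, sub0r, addr0) => /eqP; rewrite oppr_eq0 => /eqP.
have p022 : p e0 e2 e2 = 0.
  by have := b2 e0; rewrite !z12 p021 !(subr0, sub0r, add0r, oppr0).
have p120 : p e1 e2 e0 = 0.
  by have := b1 e1; rewrite !z12 p122 !(add0r, addr0).
have p020 : p e0 e2 e0 = 0 by rewrite a0.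
have p012 : p e0 e1 e2 = 0.
  by have := b1 e0; rewrite p010 p020 p022 !(add0r, addr0).
have p210 : p e2 e1 e0 = 0.
  by have := b1 e2; rewrite !z12 p212 !(addr0).
have p200 : p e2 e0 e0 = 0.
  by have := b0 e2; rewrite p201 p210 p211 !(subr0, addr0).
have p202 : p e2 e0 e2 = 0.
  have := b2 e2; rewrite p201 !z12 oppr0 !(sub0r, addr0).
  by move=> /eqP; rewrite oppr_eq0 => /eqP.
have p102 : p e1 e0 e2 = 0 by rewrite a2 p202 oppr0.
have p121 : p e1 e2 e1 = 0.
  have := b2 e1; rewrite p101 p102 p122 !(subr0, add0r, addr0).
  by move=> /eqP; rewrite oppr_eq0 => /eqP.
by apply: ord3P; apply: ord3P; apply: ord3P.
Qed.
End LocalConfiguration.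

(** * Spanning for one triple of summands *)

(** Lets data indexed by R be carried by members of A, so that a function can
    be defined on A by what it does for each label. *)
Lemma label_set (T R : finType) (A : {set T}) : (#|R| <= #|A|)%N ->
  exists h : T -> option R, forall q, exists2 B, B \in A & h B = Some q.
Proof.
move=> leRA.
pose g (q : R) : T := enum_val (widen_ord leRA (enum_rank q)).
have g_inj : injective g.
  move=> q q' /enum_val_inj/(congr1 val)/= /val_inj; exact: enum_rank_inj.
exists (fun B => [pick q | g q == B]) => q.
exists (g q); first exact: enum_valP.
by case: pickP => [q' /eqP/g_inj-> //|/(_ q)]; rewrite eqxx.
Qed.

Section LocalSpanning.
Variables (F : comNzRingType) (X : finType) (r : nat) (BB : {set {set X}}).
Local Notation J := ('I_r * 'I_3)%type.

(** The constraints that the blocks put on a trilinear form psi on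
    V_i x V_j x V_l.  The vector that block B places in the summand m is
    a B m; a summand is cut into r pieces of dimension 3, whence the
    coordinates J. *)
Definition locally_spanning (a : {set X} -> X -> J -> F) (i j l : X) :=
  forall psi : J -> J -> J -> F,
  (forall B, B \in BB -> i \in B -> j \in B -> forall z,
     \sum_x \sum_y a B i x * a B j y * psi x y z = 0) ->
  (forall B, B \in BB -> i \in B -> l \in B -> forall y,
     \sum_x \sum_z a B i x * a B l z * psi x y z = 0) ->
  (forall B, B \in BB -> j \in B -> l \in B -> forall x,
     \sum_y \sum_z a B j y * a B l z * psi x y z = 0) ->
  forall x y z, psi x y z = 0.

(** A block through i and j that contains l would have to serve several pairs
    of indices at once; blocks that avoid l can be used for i, j alone. *)
Definition blocks_avoiding (i j l : X) :=
  [set B in BB | [&& i \in B, j \in B & l \notin B]].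

Definition spread (rho : 'I_r) (f : 'I_3 -> F) (x : J) : F :=
  (x.1 == rho)%:R * f x.2.

Lemma sum_spread rho f (g : J -> F) :
  \sum_x spread rho f x * g x = \sum_i f i * g (rho, i).
Proof.
pose G c i := spread rho f (c, i) * g (c, i).
rewrite (eq_bigr (fun x => G x.1 x.2)) => [|[] //]; rewrite -(pair_bigA _ G) /G /=.
rewrite (bigD1 rho) //= [X in _ + X]big1 ?addr0 => [|c /negPf hc].
  by apply: eq_bigr => i _; rewrite /spread eqxx mul1r.
by rewrite big1 // => i _; rewrite /spread hc !mul0r.
Qed.

Lemma sum2_spread rho f rho' f' (g : J -> J -> F) :
  \sum_x \sum_y spread rho f x * spread rho' f' y * g x y
  = \sum_i \sum_j f i * f' j * g (rho, i) (rho', j).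
Proof.
under eq_bigr => x _.
  under eq_bigr => y _ do rewrite -mulrA.
  rewrite -big_distrr /= sum_spread.
  over.
rewrite /= sum_spread; apply: eq_bigr => i _; rewrite big_distrr.
by apply: eq_bigr => j _; rewrite /= mulrA.
Qed.

(** For each choice of one piece in each of V_i, V_j, V_l, the 27 values of psi
    on these pieces are killed by one copy of the configuration in dimension 3.
    The pieces of V_i and V_j are paired in r^2 ways, with 3 pairs of vectors
    each, so 3 r^2 blocks through i and j are enough. *)
Lemma locally_spanning_exists i j l :
  i != j -> i != l -> j != l ->
  (3 * r ^ 2 <= #|blocks_avoiding i j l|)%N ->
  (3 * r ^ 2 <= #|blocks_avoiding i l j|)%N ->
  (3 * r ^ 2 <= #|blocks_avoiding j l i|)%N ->
  exists a, locally_spanning a i j l.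
Proof.
move=> ij il jl; have -> : (3 * r ^ 2 = #|{: 'I_r * 'I_r * 'I_3}|)%N.
  by rewrite !card_prod !card_ord mulnC -mulnn.
move=> /label_set[h12 H12] /label_set[h13 H13] /label_set[h23 H23].
pose place (m1 m2 : X) (f g : 'I_3 -> 'I_3 -> F) (h : option ('I_r * 'I_r * 'I_3))
    (m : X) (x : J) : F :=
  if h is Some (rho, rho', t)
  then if m == m1 then spread rho (f t) x else spread rho' (g t) x else 0.
pose a (B : {set X}) : X -> J -> F :=
  if l \notin B then place i j (@left12 F) (@right12 F) (h12 B)
  else if j \notin B then place i l (@left13 F) (@right13 F) (h13 B)
  else place j l (@left23 F) (@right23 F) (h23 B).
exists a => psi k12 k13 k23 [rho x] [rho' y] [rho'' z].
pose p x y z := psi (rho, x) (rho', y) (rho'', z).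
suff: p x y z = 0 by [].
apply: local_configuration_spans => {x y z} t w.
- have [B] := H12 (rho, rho', t); rewrite inE => /and4P[hB iB jB lB] hq.
  have /= := k12 B hB iB jB (rho'', w).
  rewrite /a lB /place hq /= eqxx eq_sym (negPf ij).
  by rewrite (sum2_spread _ _ _ _ (fun x y => psi x y (rho'', w))).
- have [B] := H13 (rho, rho'', t); rewrite inE => /and4P[hB iB lB jB] hq.
  have /= := k13 B hB iB lB (rho', w).
  rewrite /a lB jB /place hq /= eqxx eq_sym (negPf il) /=.
  by rewrite (sum2_spread _ _ _ _ (fun x z => psi x (rho', w) z)).
- have [B] := H23 (rho', rho'', t); rewrite inE => /and4P[hB jB lB iB] hq.
  have /= := k23 B hB jB lB (rho, w).
  rewrite /a lB jB /place hq /= eqxx eq_sym (negPf jl) /=.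
  by rewrite (sum2_spread _ _ _ _ (fun y z => psi (rho, w) y z)).
Qed.
End LocalSpanning.

(** * Generic choice of the vectors *)

Lemma poly_nonroot (F : numFieldType) (p : {poly F}) : p != 0 -> exists t, ~~ root p t.
Proof.
move=> p0; apply: contrapT => /forallNP allroot.
pose s : seq F := [seq n%:R | n <- iota 0 (size p)].
have s_uniq : uniq s.
  by rewrite map_inj_uniq ?iota_uniq // => m n /eqP; rewrite eqr_nat => /eqP.
have s_root : all (root p) s by apply/allP => t _; apply/negPn/negP/allroot.
by have := max_poly_roots p0 s_root s_uniq; rewrite size_map size_iota ltnn.
Qed.

Lemma poly_eq0_nonroot (F : numFieldType) (p q : {poly F}) :
  q != 0 -> (forall t, ~~ root q t -> p.[t] = 0) -> p = 0.
Proof.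
move=> q0 h; apply/eqP; apply: contraT => p0.
have [t] := poly_nonroot (mulf_neq0 p0 q0).
by rewrite rootM negb_or => /andP[/negP pt qt]; case: pt; apply/rootP/h.
Qed.

Lemma poly_eq0_all (F : numFieldType) (p : {poly F}) : (forall t, p.[t] = 0) -> p = 0.
Proof. by move=> h; apply: (poly_eq0_nonroot (oner_neq0 _)) => t _; apply: h. Qed.

Lemma sum_enum_val (V : nmodType) (J : finType) (f : J -> V) :
  \sum_(k < #|J|) f (enum_val k) = \sum_j f j.
Proof.
rewrite [RHS](reindex (@enum_val J J)) //.
by exists enum_rank => ? _; rewrite ?enum_valK ?enum_rankK.
Qed.

Section Duality.
Variables (F : fieldType) (I J : finType).

Lemma mem_span_dual (D : I -> J -> F) (w : J -> F) :
  (forall c : J -> F, (forall i, \sum_j D i j * c j = 0) -> \sum_j w j * c j = 0) ->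
  exists lam : I -> F, forall j, w j = \sum_i lam i * D i j.
Proof.
move=> h.
pose M := \matrix_(i < #|I|, j < #|J|) D (enum_val i) (enum_val j).
pose W := \row_(j < #|J|) w (enum_val j).
have /submxP[L hL] : (W <= M)%MS.
  rewrite submxE; apply/eqP/rowP => b; rewrite [RHS]mxE [LHS]mxE.
  pose c j := cokermx M (enum_rank j) b.
  rewrite (eq_bigr (fun k => w (enum_val k) * c (enum_val k))); last first.
    by move=> k _; rewrite /c enum_valK [W _ _]mxE.
  rewrite (sum_enum_val (fun j => w j * c j)); apply: h => i.
  have : (M *m cokermx M) (enum_rank i) b = 0 by rewrite mulmx_coker mxE.
  rewrite mxE => hz; rewrite -[RHS]hz.
  rewrite -(sum_enum_val (fun j => D i j * c j)); apply: eq_bigr => k _.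
  by rewrite [M _ _]mxE enum_rankK /c enum_valK.
exists (fun i => L 0 (enum_rank i)) => j.
have /rowP/(_ (enum_rank j)) := hL; rewrite !mxE enum_rankK => ->.
rewrite -(sum_enum_val (fun i => L 0 (enum_rank i) * D i j)); apply: eq_bigr => k _.
by rewrite !mxE enum_rankK enum_valK.
Qed.
End Duality.

(** Having full column rank is an open condition: it is witnessed by a minor,
    whose value is a polynomial when the entries are polynomials. *)
Section Minor.
Variables (F : fieldType) (I J : finType).

Definition separating (D : I -> J -> F) :=
  forall c : J -> F, (forall i, \sum_j D i j * c j = 0) -> forall j, c j = 0.

Lemma separating_open (Q : I -> J -> {poly F}) t0 :
  separating (fun i j => (Q i j).[t0]) ->
  exists2 p : {poly F}, p != 0 &
    forall t, ~~ root p t -> separating (fun i j => (Q i j).[t]).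
Proof.
move=> sep0.
have span j0 := @mem_span_dual F I J (fun i j => (Q i j).[t0]) (fun j => (j == j0)%:R).
have {span} /choice[lam hlam] : forall j0, exists lam : I -> F, forall j,
    (j == j0)%:R = \sum_i lam i * (Q i j).[t0].
  move=> j0; apply: span => c /sep0 c0.
  by apply: big1 => j _; rewrite c0 mulr0.
pose M := \matrix_(k < #|J|, j < #|J|)
   \sum_i (lam (enum_val k) i)%:P * Q i (enum_val j).
pose p := \det M.
have pE t : p.[t] = \det (map_mx (horner^~ t) M).
  by rewrite -[LHS]horner_evalE -det_map_mx.
exists p.
  apply: contraTneq (oner_neq0 F) => p0; rewrite negbK eq_sym.
  rewrite -[X in X == _](horner0 t0) -p0 pE.
  rewrite (_ : map_mx _ _ = 1%:M) ?det1 //; apply/matrixP=> k j; rewrite !mxE horner_sum.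
  under eq_bigr => i _ do rewrite hornerM hornerC.
  by rewrite -hlam (inj_eq enum_val_inj) eq_sym.
move=> t pt c hc j.
have Mt : map_mx (horner^~ t) M \in unitmx by rewrite unitmxE -pE unitfE.
have : map_mx (horner^~ t) M *m (\col_k c (enum_val k)) = 0.
  apply/matrixP => k z; rewrite !mxE.
  under eq_bigr => b _ do rewrite !mxE horner_sum big_distrl /=.
  rewrite exchange_big big1 //= => i _.
  under eq_bigr => b _ do rewrite hornerM hornerC -mulrA.
  rewrite -big_distrr /= (sum_enum_val (fun j => (Q i j).[t] * c j)).
  by rewrite hc mulr0.
move/(congr1 (mulmx (invmx (map_mx (horner^~ t) M)))).
rewrite mulKmx // mulmx0 => /matrixP/(_ (enum_rank j) 0).
by rewrite !mxE enum_rankK.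
Qed.
End Minor.

(** A weak form of being generic: nonempty, and on each line either empty or
    cofinite.  It needs no polynomials in several variables, and two such
    conditions are met at once on the line that joins a point of the first to a
    point of the second. *)
Section GenericOnLines.
Variables (F : numFieldType) (E : Type) (line : E -> E -> F -> E).
Hypothesis line0 : forall a b, line a b 0 = a.
Hypothesis line1 : forall a b, line a b 1 = b.

Definition generic_on_lines (P : E -> Prop) :=
  (exists a, P a) /\
  forall a b t0, P (line a b t0) ->
    exists2 p : {poly F}, p != 0 & forall t, ~~ root p t -> P (line a b t).

Lemma generic_on_linesI P Q :
  generic_on_lines P -> generic_on_lines Q -> generic_on_lines (fun a => P a /\ Q a).
Proof.
move=> [[a Pa] Popen] [[b Qb] Qopen]; split.
  have [p p0 hp] : exists2 p : {poly F}, p != 0 & forall t, ~~ root p t -> P (line a b t).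
    by apply: (Popen _ _ 0); rewrite line0.
  have [q q0 hq] : exists2 p : {poly F}, p != 0 & forall t, ~~ root p t -> Q (line a b t).
    by apply: (Qopen _ _ 1); rewrite line1.
  have [t] := poly_nonroot (mulf_neq0 p0 q0); rewrite rootM negb_or => /andP[pt qt].
  by exists (line a b t); split; [exact: hp|exact: hq].
move=> c d t0 [/Popen[p p0 hp] /Qopen[q q0 hq]].
exists (p * q); first exact: mulf_neq0.
by move=> t; rewrite rootM negb_or => /andP[/hp pt /hq qt].
Qed.

Lemma generic_on_lines_all (T : eqType) (s : seq T) (P : T -> E -> Prop) :
  inhabited E ->
  (forall x, x \in s -> generic_on_lines (P x)) ->
  generic_on_lines (fun a => forall x, x \in s -> P x a).
Proof.
move=> [e]; elim: s => [_|x s IH h].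
  split; first by exists e.
  by move=> a b t0 _; exists 1; first exact: oner_neq0.
have gx : generic_on_lines (P x) by apply: h; rewrite mem_head.
have gs : generic_on_lines (fun a => forall y, y \in s -> P y a).
  by apply: IH => y ys; apply: h; rewrite inE ys orbT.
have [[a [Pa Pas]] op] := generic_on_linesI gx gs; split.
  by exists a => y; rewrite inE => /predU1P[->|/Pas].
move=> b c t0 Pt0; have [|p p0 hp] := op b c t0.
  by split=> [|y ys]; apply: Pt0; rewrite inE ?eqxx ?ys ?orbT.
by exists p => // t /hp[Px Ps] y; rewrite inE => /predU1P[->|/Ps].
Qed.
End GenericOnLines.

Section LocalGeneric.
Variables (F : numFieldType) (X : finType) (r : nat) (BB : {set {set X}}).
Local Notation J := ('I_r * 'I_3)%type.
Local Notation frames := ({set X} -> X -> J -> F).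

Definition frame_line (a b : frames) (t : F) : frames :=
  fun B m x => a B m x + t * (b B m x - a B m x).

Lemma frame_line0 a b : frame_line a b 0 = a.
Proof. by do 3!apply/funext => ?; rewrite /frame_line mul0r addr0. Qed.

Lemma frame_line1 a b : frame_line a b 1 = b.
Proof. by do 3!apply/funext => ?; rewrite /frame_line mul1r addrC subrK. Qed.

Section Constraints.
Variables (R : comNzRingType) (a : {set X} -> X -> J -> R) (i j l : X).

(** The conditions of locally_spanning as rows of a matrix, indexed by the pair
    of factors e, the block B and the coordinate w of the free argument; the
    rows that impose nothing are 0. *)
Definition constraint (k : 'I_3 * {set X} * J) (q : J * J * J) : R :=
  let: (e, B, w) := k in let: (x, y, z) := q in
  if B \in BB then
    match val e with
    | 0 => if (i \in B) && (j \in B) then (a B i x * a B j y) *+ (z == w) else 0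
    | 1 => if (i \in B) && (l \in B) then (a B i x * a B l z) *+ (y == w) else 0
    | _ => if (j \in B) && (l \in B) then (a B j y * a B l z) *+ (x == w) else 0
    end
  else 0.
End Constraints.

Lemma sum_triple (G : J * J * J -> F) :
  \sum_q G q = \sum_x \sum_y \sum_z G (x, y, z).
Proof.
by rewrite pair_bigA pair_bigA; apply: eq_bigr => [[[x y] z]] _.
Qed.

Lemma sum_pick (w : J) (G : J -> F) (b : J -> F) :
  \sum_z b z *+ (z == w) * G z = b w * G w.
Proof.
rewrite (bigD1 w) //= eqxx mulr1n big1 ?addr0 // => z /negPf ->.
by rewrite mulr0n mul0r.
Qed.

Lemma locally_spanning_separating (a : frames) i j l :
  locally_spanning BB a i j l <-> separating (constraint a i j l).
Proof.
pose o0 : 'I_3 := ord0; pose o1 : 'I_3 := lift ord0 ord0; pose o2 : 'I_3 := ord_max.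
have E0 B w c : B \in BB -> i \in B -> j \in B ->
    \sum_q constraint a i j l (o0, B, w) q * c q =
    \sum_x \sum_y a B i x * a B j y * c (x, y, w).
  move=> hB hi hj; rewrite sum_triple; do 2!apply: eq_bigr => ? _.
  by rewrite /constraint hB hi hj /= (sum_pick _ (fun z => c (_, z))).
have E1 B w c : B \in BB -> i \in B -> l \in B ->
    \sum_q constraint a i j l (o1, B, w) q * c q =
    \sum_x \sum_z a B i x * a B l z * c (x, w, z).
  move=> hB hi hj; rewrite sum_triple; apply: eq_bigr => x _.
  rewrite exchange_big; apply: eq_bigr => z _.
  rewrite /constraint hB hi hj /=.
  by rewrite (sum_pick _ (fun y => c (x, y, z)) (fun=> _)).
have E2 B w c : B \in BB -> j \in B -> l \in B ->
    \sum_q constraint a i j l (o2, B, w) q * c q =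
    \sum_y \sum_z a B j y * a B l z * c (w, y, z).
  move=> hB hi hj; rewrite sum_triple exchange_big; apply: eq_bigr => y _.
  rewrite exchange_big; apply: eq_bigr => z _.
  rewrite /constraint hB hi hj /=.
  by rewrite (sum_pick _ (fun x => c (x, y, z)) (fun=> _)).
split=> [sp c hc [[x y] z]|sep psi h12 h13 h23 x y z].
  apply: (sp (fun x y z => c (x, y, z))) => B hB hi hj w.
  - by rewrite -E0.
  - by rewrite -E1.
  - by rewrite -E2.
pose c q := let: (x, y, z) := q in psi x y z.
apply: (sep c _ (x, y, z)) => -[[e B] w].
have [hB|nB] := boolP (B \in BB); last first.
  by apply: big1 => -[[? ?] ?] _; rewrite /constraint (negPf nB) mul0r.
move: e; apply: ord3P.
- have [/andP[hi hj]|nij] := boolP ((i \in B) && (j \in B)); first by rewrite E0 ?h12.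
  by apply: big1 => -[[? ?] ?] _; rewrite /constraint hB /= (negPf nij) mul0r.
- have [/andP[hi hj]|nij] := boolP ((i \in B) && (l \in B)); first by rewrite E1 ?h13.
  by apply: big1 => -[[? ?] ?] _; rewrite /constraint hB /= (negPf nij) mul0r.
- have [/andP[hi hj]|nij] := boolP ((j \in B) && (l \in B)).
    by rewrite (_ : lift _ _ = o2) ?E2 ?h23 //; apply: val_inj.
  by apply: big1 => -[[? ?] ?] _; rewrite /constraint hB /= (negPf nij) mul0r.
Qed.

Lemma locally_spanning_open a b t0 i j l :
  locally_spanning BB (frame_line a b t0) i j l ->
  exists2 p : {poly F}, p != 0 &
    forall t, ~~ root p t -> locally_spanning BB (frame_line a b t) i j l.
Proof.
pose A B m x : {poly F} := (a B m x)%:P + 'X * (b B m x - a B m x)%:P.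
have AE t B m x : (A B m x).[t] = frame_line a b t B m x.
  by rewrite /A hornerD hornerM !hornerC hornerX.
have cE t : constraint (frame_line a b t) i j l
    = fun k q => (constraint A i j l k q).[t].
  apply/funext => -[[e B] w]; apply/funext => -[[x y] z]; rewrite /constraint.
  case: ifP => _; last by rewrite horner0.
  by case: (val e) => [|[|?]]; case: ifP => _; rewrite ?horner0 ?hornerMn ?hornerM ?AE.
move=> /locally_spanning_separating; rewrite cE => /separating_open[p p0 hp].
by exists p => // t /hp; rewrite -cE => /locally_spanning_separating.
Qed.

(** Each triple i, j, l has its own good vectors; since the condition that it
    imposes is generic on lines, so is the conjunction of all of them. *)
Lemma common_frames :
  (forall i j l, i != j -> i != l -> j != l ->
     (3 * r ^ 2 <= #|blocks_avoiding BB i j l|)%N) ->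
  exists a : frames, forall i j l, i != j -> i != l -> j != l ->
    locally_spanning BB a i j l.
Proof.
move=> hBB.
pose D := [seq q <- enum {: X * X * X} |
  [&& q.1.1 != q.1.2, q.1.1 != q.2 & q.1.2 != q.2]].
have gen : forall q, q \in D -> generic_on_lines frame_line
    (fun a => locally_spanning BB a q.1.1 q.1.2 q.2).
  move=> [[i j] l]; rewrite mem_filter /= => /andP[/and3P[ij il jl] _].
  split; last by move=> a b t0; apply: locally_spanning_open.
  by apply: locally_spanning_exists; rewrite // hBB // eq_sym.
have [|[a ha] _] := generic_on_lines_all frame_line0 frame_line1 _ gen.
  by split=> ? ? ?; apply: 0.
exists a => i j l ij il jl; apply: (ha (i, j, l)).
by rewrite mem_filter /= ij il jl mem_enum.
Qed.
End LocalGeneric.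

(** * A design with few blocks *)

Section SumDesign.
Variables (K sigma : nat).
Local Notation X := 'I_K.+1.
Hypothesis leK : (sigma <= K.+1)%N.

(** A pair of points i, j lies in one block for each sum s below sigma, the
    third point being s - i - j, except when this is i or j: a nearly regular
    design, with nearly the least possible number of blocks. *)
Definition sum_design : {set {set X}} :=
  [set B : {set X} | (#|B| == 3) && ((\sum_(x in B) x)%R < sigma)%N].

Definition small_sums : {set X} := [set s : X | (s < sigma)%N].

Lemma card_small_sums : #|small_sums| = sigma.
Proof.
have inj : injective (widen_ord leK) by move=> a b /(congr1 val)/= /val_inj.
rewrite -[RHS]card_ord -cardsT -(card_imset _ inj).
apply: eq_card => s; rewrite inE; apply/idP/imsetP => [lt|[a _ ->]]; last exact: (ltn_ord a).
by exists (Ordinal lt) => //; apply: val_inj.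
Qed.

Lemma sum_block (i j z : X) : i != j -> z != i -> z != j ->
  \sum_(x in i |: (j |: [set z])) x = i + j + z.
Proof.
move=> ij zi zj; rewrite big_setU1 /=; last by rewrite !inE negb_or ij eq_sym.
by rewrite big_setU1 /= ?big_set1 ?addrA // inE eq_sym.
Qed.

Lemma card_block (i j z : X) : i != j -> z != i -> z != j ->
  #|i |: (j |: [set z])| = 3%N.
Proof.
move=> ij zi zj.
by rewrite !cardsU1 cards1 !inE negb_or ij (eq_sym i z) (eq_sym j z) zi zj.
Qed.

Lemma block_through (B : {set X}) (i j : X) : #|B| = 3%N -> i \in B -> j \in B -> i != j ->
  exists z, [/\ B = i |: (j |: [set z]), z != i & z != j].
Proof.
move=> cB iB jB ij.
have jB' : j \in B :\ i by rewrite !inE eq_sym ij.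
have /eqP/cards1P[z hz] : #|B :\ i :\ j| = 1%N.
  by have := cardsD1 i B; rewrite (cardsD1 j (B :\ i)) jB' iB cB !add1n => -[].
exists z; have : z \in B :\ i :\ j by rewrite hz set11.
by rewrite !inE => /and3P[-> -> _]; rewrite -hz !finset.setD1K.
Qed.

(** The three sums that are lost are those for which the third point is i, j
    or l. *)
Lemma card_blocks_avoiding (i j l : X) : i != j -> i != l -> j != l ->
  (sigma <= #|blocks_avoiding sum_design i j l| + 3)%N.
Proof.
move=> ij il jl.
pose bad := (i + j + i) |: ((i + j + j) |: [set i + j + l]).
pose f (s : X) := i |: (j |: [set s - i - j]).
have bal s : i + j + (s - i - j) = s by rewrite addrC -[X in X + _]addrA -opprD subrK.
have fP s : s \in small_sums :\: bad ->
    [/\ s - i - j != i, s - i - j != j & s - i - j != l].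
  rewrite !inE !negb_or => /andP[/and3P[h1 h2 h3] _].
  have E x : s = i + j + x <-> s - i - j = x.
    split=> [->|<-]; last by rewrite bal.
    by rewrite -addrA -opprD addrAC subrr add0r.
  by split; [move: h1|move: h2|move: h3]; apply: contraNN => /eqP/E/eqP.
have fsum s : s \in small_sums :\: bad -> \sum_(x in f s) x = s.
  by move=> /fP[h1 h2 _]; rewrite sum_block // bal.
have f_inj : {in small_sums :\: bad &, injective f}.
  by move=> s s' hs hs' e; rewrite -(fsum s) // e fsum.
have sub : f @: (small_sums :\: bad) \subset blocks_avoiding sum_design i j l.
  apply/fintype.subsetP => B /imsetP[s hs ->]; have [h1 h2 h3] := fP s hs.
  have fB : f s \in sum_design.
    rewrite [_ \in _]inE fsum // card_block //=; move: hs.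
    by rewrite [_ \in _ :\: _]inE => /andP[_]; rewrite inE.
  rewrite [_ \in _]inE fB /f !inE !eqxx /= orbT !negb_or.
  by rewrite (eq_sym l i) (eq_sym l j) (eq_sym l) il jl h3.
move: (subset_leq_card sub); rewrite card_in_imset // => le.
have := cardsID bad small_sums; rewrite card_small_sums => <-; rewrite addnC.
rewrite leq_add //; apply: leq_trans (subset_leq_card (finset.subsetIr _ _)) _.
by rewrite !cardsU1 cards1; lia.
Qed.

(** Double counting of the triples (B, x, y) with x and y distinct in B: each
    block gives 6 of them, and a block through x and y is determined by its
    sum. *)
Lemma card_sum_design : (6 * #|sum_design| <= K.+1 ^ 2 * sigma)%N.
Proof.
pose c (B : {set X}) x y : nat := [&& x \in B, y \in B & x != y].
have six B : B \in sum_design -> (\sum_x \sum_y c B x y = 6)%N.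
  rewrite inE => /andP[/eqP cB _].
  transitivity (\sum_(x in B) 2)%N; last by rewrite sum_nat_const cB.
  rewrite [RHS]big_mkcond; apply: eq_bigr => x _; case: ifP => xB; last first.
    by rewrite big1 // => y _; rewrite /c xB.
  transitivity #|B :\ x|; last by have := cardsD1 x B; rewrite xB cB add1n => -[].
  rewrite -sum1_card [RHS]big_mkcond; apply: eq_bigr => y _.
  by rewrite /c xB !inE andTb andbC eq_sym; case: ifP.
have -> : (6 * #|sum_design| = \sum_(B in sum_design) \sum_x \sum_y c B x y)%N.
  by rewrite mulnC -sum_nat_const; apply: eq_bigr => B /six.
rewrite exchange_big; under eq_bigr => x _ do rewrite exchange_big /=.
have -> : (K.+1 ^ 2 * sigma = \sum_(x : X) \sum_(y : X) sigma)%N.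
  by rewrite !sum_nat_const !card_ord; lia.
apply: leq_sum => x _; apply: leq_sum => y _.
have [->|xy] := eqVneq x y; first by rewrite big1 // => B _; rewrite /c eqxx !andbF.
pose D := [set B in sum_design | (x \in B) && (y \in B)].
have -> : (\sum_(B in sum_design) c B x y = #|D|)%N.
  rewrite -sum1_card big_mkcond [RHS]big_mkcond; apply: eq_bigr => B _.
  by rewrite [B \in D]inE /c xy andbT; case: (B \in sum_design) => //=; case: (_ && _).
have s_inj : {in D &, injective (fun B : {set X} => \sum_(x in B) x)}.
  move=> B B'; rewrite !inE => /and3P[/andP[/eqP c1 _] x1 y1] /and3P[/andP[/eqP c2 _] x2 y2].
  have [z [-> zx zy]] := block_through c1 x1 y1 xy.
  have [z' [-> zx' zy']] := block_through c2 x2 y2 xy.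
  by rewrite !sum_block // => /addrI ->.
rewrite -(card_in_imset s_inj) -[leqRHS]card_small_sums; apply/subset_leq_card/fintype.subsetP.
by move=> s /imsetP[B]; rewrite !inE => /andP[/andP[_ h] _] ->.
Qed.
End SumDesign.

(** * Frames that separate alternating forms *)

Section AlternatingForms.
Variables (F : numFieldType) (N : nat).
Implicit Types (x y z u : 'rV[F]_N).

Record alternating_form (phi : 'rV[F]_N -> 'rV[F]_N -> 'rV[F]_N -> F) : Prop := {
  form_linear : forall x y c z z', phi x y (c *: z + z') = c * phi x y z + phi x y z';
  form_swap12 : forall x y z, phi y x z = - phi x y z;
  form_swap23 : forall x y z, phi x z y = - phi x y z
}.

Definition kills_frame (phi : 'rV[F]_N -> 'rV[F]_N -> 'rV[F]_N -> F) (v : 'M[F]_(3, N)) :=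
  forall a b u, a != b -> phi (row a v) (row b v) u = 0.

Variable phi : 'rV[F]_N -> 'rV[F]_N -> 'rV[F]_N -> F.
Hypothesis alt : alternating_form phi.

Lemma form_cycle x y z : phi y z x = phi x y z.
Proof. by rewrite (form_swap23 alt) (form_swap12 alt) opprK. Qed.

Lemma form_sum3 (I : finType) x y (c : I -> F) (e : I -> 'rV_N) :
  phi x y (\sum_i c i *: e i) = \sum_i c i * phi x y (e i).
Proof.
elim/big_rec2: _ => [|i s z _ <-]; last by rewrite (form_linear alt).
have := form_linear alt x y 1 0 0; rewrite scale1r addr0 mul1r => /eqP.
by rewrite -subr_eq0 opprD addNKr oppr_eq0 => /eqP.
Qed.

Lemma form_sum12 (I : finType) (c d : I -> F) (e f : I -> 'rV_N) u :
  phi (\sum_i c i *: e i) (\sum_j d j *: f j) u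
  = \sum_i \sum_j c i * d j * phi (e i) (f j) u.
Proof.
rewrite -form_cycle form_sum3; apply: eq_bigr => i _.
rewrite 2!form_cycle form_sum3 big_distrr; apply: eq_bigr => j _ /=.
by rewrite mulrA -form_cycle.
Qed.

Lemma form_eq0_basis : (forall a b c, phi (delta_mx 0 a) (delta_mx 0 b) (delta_mx 0 c) = 0) ->
  forall x y z, phi x y z = 0.
Proof.
move=> h x y z; rewrite (row_sum_delta x) (row_sum_delta y) (row_sum_delta z).
rewrite form_sum12 big1 // => a _; rewrite big1 // => b _.
by rewrite form_sum3 big1 ?mulr0 // => c _; rewrite h mulr0.
Qed.
End AlternatingForms.

Section Frames.
Variables (F : numFieldType) (n K r : nat).
Local Notation N := n.+1.
Local Notation X := 'I_K.+1.
Local Notation J := ('I_r * 'I_3)%type.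
Hypothesis design_fits : (3 * r ^ 2 + 3 <= K.+1)%N.
Hypothesis space_fits : (N <= K.+1 * (r * 3))%N.

(** The frames inner (e, e', 0), with e and e' basis vectors of one summand,
    make phi vanish on two arguments from one summand; they number O(r^2 K),
    which is negligible against K^2.  The frames outer come from the blocks.
    The dimension n + 1 may be less than the total 3r(K+1): the V_i then
    span the space without being independent, and the argument only uses that
    they span. *)
Lemma separating_frames : exists vs : seq 'M[F]_(3, N),
  (6 * size vs <= K.+1 ^ 2 * (3 * r ^ 2 + 3) + 54 * (r ^ 2 * K.+1))%N /\
  forall phi, alternating_form phi -> (forall v, v \in vs -> kills_frame phi v) ->
  forall x y z, phi x y z = 0.
Proof.
pose BB := sum_design K (3 * r ^ 2 + 3).
have [a ha] : exists a : {set X} -> X -> J -> F, forall i j l,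
    i != j -> i != l -> j != l -> locally_spanning BB a i j l.
  apply: common_frames => i j l ij il jl.
  by rewrite -(leq_add2r 3); apply: card_blocks_avoiding.
pose e (m : X) (x : J) : 'rV[F]_N := delta_mx 0 (inord (enum_rank (m, x))).
have e_onto (c : 'I_N) : exists m x, delta_mx 0 c = e m x.
  have lt : (c < #|{: X * J}|)%N.
    by rewrite !card_prod !card_ord (leq_trans _ space_fits).
  exists (enum_val (Ordinal lt)).1, (enum_val (Ordinal lt)).2.
  by rewrite /e -surjective_pairing enum_valK /= inord_val.
pose point (B : {set X}) m := \sum_x a B m x *: e m x.
(* The list has two entries: the third row is the default value 0. *)
pose inner (q : X * J * J) : 'M[F]_(3, N) :=
  \matrix_(k < 3) nth 0 [:: e q.1.1 q.1.2; e q.1.1 q.2] k.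
pose outer (B : {set X}) : 'M[F]_(3, N) := \matrix_(k < 3) point B (nth ord0 (enum B) k).
exists (map inner (enum {: X * J * J}) ++ map outer (enum BB)); split.
  rewrite size_cat (size_map inner) (size_map outer) -cardT -cardE !card_prod !card_ord.
  rewrite mulnDr addnC leq_add ?card_sum_design //; last by rewrite -mulnn; lia.
move=> phi alt kill; apply: (form_eq0_basis alt) => b1 b2 b3.
have [[i [x ->]] [j [y ->]] [l [z ->]]] := And3 (e_onto b1) (e_onto b2) (e_onto b3).
have in0 m x1 x2 u : phi (e m x1) (e m x2) u = 0.
  have := kill (inner (m, x1, x2)); rewrite mem_cat map_f ?mem_enum // => /(_ isT).
  by move=> /(_ ord0 (lift ord0 ord0) u isT); rewrite !rowK.
have [<-|ij] := eqVneq i j; first exact: in0.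
have [<-|il] := eqVneq i l.
  by rewrite (form_swap23 alt) in0 oppr0.
have [<-|jl] := eqVneq j l; first by rewrite -(form_cycle alt) in0.
have out0 B m1 m2 u : B \in BB -> m1 \in B -> m2 \in B -> m1 != m2 ->
    \sum_x1 \sum_x2 a B m1 x1 * a B m2 x2 * phi (e m1 x1) (e m2 x2) u = 0.
  move=> hB h1 h2 m12; rewrite -(form_sum12 alt).
  have sB : size (enum B) = 3%N by move: hB; rewrite inE -cardE => /andP[/eqP].
  have idx m : m \in B -> (index m (enum B) < 3)%N.
    by move=> hm; rewrite -sB index_mem mem_enum.
  have := kill (outer B); rewrite mem_cat (map_f outer) ?mem_enum // orbT => /(_ isT).
  move=> /(_ (Ordinal (idx _ h1)) (Ordinal (idx _ h2)) u).
  rewrite !rowK /= !nth_index ?mem_enum //; apply.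
  apply: contraNneq m12 => /(congr1 val)/= eqi.
  by rewrite -(nth_index ord0 (_ : m1 \in enum B)) ?mem_enum // eqi nth_index ?mem_enum.
apply: (ha i j l ij il jl (fun x y z => phi (e i x) (e j y) (e l z))) => B hB hi hj w.
- exact: out0.
- rewrite -[RHS]oppr0 -[X in _ = - X](out0 B i l (e j w)) // -sumrN; apply: eq_bigr => x1 _.
  by rewrite -sumrN; apply: eq_bigr => x2 _; rewrite -mulrN (form_swap23 alt).
- rewrite -[RHS](out0 B j l (e i w)) //; do 2!apply: eq_bigr => ? _.
  by rewrite [in RHS](form_cycle alt).
Qed.
End Frames.

(** * Tangent spaces at sums of decomposable tensors *)

Local Notation i0 := (@ord0 2).
Local Notation i1 := (lift (@ord0 2) (@ord0 1)).
Local Notation i2 := (lift (@ord0 2) (lift (@ord0 1) (@ord0 0))).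

Lemma sum_ord3 (V : nmodType) (f : 'I_3 -> V) : \sum_i f i = f i0 + f i1 + f i2.
Proof. by rewrite !big_ord_recl big_ord0 addr0 addrA. Qed.

Lemma det_mx33 (R : comNzRingType) (A : 'M[R]_3) : \det A =
    A i0 i0 * A i1 i1 * A i2 i2 + A i0 i1 * A i1 i2 * A i2 i0
  + A i0 i2 * A i1 i0 * A i2 i1 - A i0 i2 * A i1 i1 * A i2 i0
  - A i0 i1 * A i1 i0 * A i2 i2 - A i0 i0 * A i1 i2 * A i2 i1.
Proof.
rewrite (expand_det_row _ i0) sum_ord3 /cofactor.
have det2 (B : 'M[R]_2) :
    \det B = B ord0 ord0 * B ord_max ord_max - B ord0 ord_max * B ord_max ord0.
  rewrite (expand_det_row _ ord0) !big_ord_recl big_ord0 addr0 /cofactor !det_mx11 !mxE.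
  pose g i j := B (inord i) (inord j).
  have gE x y : B x y = g (val x) (val y) by rewrite /g !inord_val.
  by rewrite !gE /= /bump /= !(addn0, addn1, expr0, expr1, mul1r, mulN1r, mulrN).
rewrite !det2 !mxE.
pose g i j := A (inord i) (inord j).
have gE x y : A x y = g (val x) (val y) by rewrite /g !inord_val.
rewrite !gE /= /bump /= !(addn0, add0n, addn1, add1n).
by ring.
Qed.

Definition set_row (R : Type) m n (A : 'M[R]_(m, n)) (a : 'I_m) (u : 'rV[R]_n) : 'M[R]_(m, n) :=
  \matrix_(b, c) if b == a then u 0 c else A b c.

(** The first-order term in x is the differential of the determinant; the rest
    is kept explicit because the dominance argument divides by x. *)
Lemma det_add_scaled (R : comNzRingType) (A B : 'M[R]_3) (x : R) :
  \det (A + x *: B) = \det A + x * (\sum_a \det (set_row A a (row a B))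
    + x * (\sum_a \det (set_row B a (row a A)) + x * \det B)).
Proof. by rewrite !sum_ord3 !det_mx33 !mxE /=; ring. Qed.

Section Tangent.
Variables (F : numFieldType) (N : nat).

(** The cofactors along row a do not involve that row. *)
Lemma minors_set_row (v : 'M[F]_(3, N)) a (u : 'rV[F]_N) i :
  minors_tensor (set_row v a u) i
  = \sum_c u 0 c * minors_tensor (set_row v a (delta_mx 0 c)) i.
Proof.
pose cof b := cofactor (colsub i v) a b.
have E w : minors_tensor (set_row v a w) i = \sum_b w 0 (i b) * cof b.
  rewrite ffunE (expand_det_row _ a); apply: eq_bigr => b _; rewrite !mxE eqxx.
  congr (_ * (_ * \det _)); apply/matrixP => k l.
  by rewrite !mxE eq_sym (negPf (neq_lift _ _)).
rewrite E; under [RHS]eq_bigr => c _ do rewrite E big_distrr /=.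
rewrite exchange_big; apply: eq_bigr => b _ /=.
rewrite (bigD1 (i b)) //= mxE !eqxx mul1r big1 ?addr0 // => c /negPf ne.
by rewrite mxE eq_sym ne andbF mul0r mulr0.
Qed.

Definition rows3 (x y z : 'rV[F]_N) : 'M[F]_(3, N) := \matrix_(a < 3) nth 0 [:: x; y; z] a.

Lemma rows3_row (v : 'M[F]_(3, N)) : rows3 (row i0 v) (row i1 v) (row i2 v) = v.
Proof. by apply/row_matrixP; apply: ord3P; rewrite rowK. Qed.

Definition minors_form (c : triple N -> F) x y z : F :=
  \sum_i minors_tensor (rows3 x y z) i * c i.

Lemma minors_form_alternating c : alternating_form (minors_form c).
Proof.
split=> x y *; rewrite /minors_form.
- rewrite big_distrr -big_split; apply: eq_bigr => i _ /=.
  by rewrite !ffunE !det_mx33 !mxE /= ?mxE; ring.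
- rewrite -sumrN; apply: eq_bigr => i _ /=.
  by rewrite !ffunE !det_mx33 !mxE /=; ring.
- rewrite -sumrN; apply: eq_bigr => i _ /=.
  by rewrite !ffunE !det_mx33 !mxE /=; ring.
Qed.

(** By duality, w is in the image of the differential when every linear
    functional c on tensors that kills the image kills w.  On decomposable
    tensors c is an alternating trilinear form, and killing the image says
    precisely that this form vanishes on two vectors of one frame. *)
Lemma tangents_span (s : nat) (v : 'I_s -> 'M[F]_(3, N)) :
  (forall phi, alternating_form phi -> (forall t, kills_frame phi (v t)) ->
     forall x y z, phi x y z = 0) ->
  forall w : wedge3 F N, exists u : 'I_s -> 'M[F]_(3, N), forall i,
    w i = \sum_t \sum_a minors_tensor (set_row (v t) a (row a (u t))) i.
Proof.
move=> sep w.
pose D (q : 'I_s * 'I_3 * 'I_N) : triple N -> F :=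
  minors_tensor (set_row (v q.1.1) q.1.2 (delta_mx 0 q.2)).
have [c hc|lam hlam] := mem_span_dual (D := D) (w := w).
  pose phi := minors_form c; have alt : alternating_form phi by apply: minors_form_alternating.
  have phi0 : forall x y z, phi x y z = 0.
    apply: sep => // t.
    have T0 a (u : 'rV[F]_N) : \sum_i minors_tensor (set_row (v t) a u) i * c i = 0.
      under eq_bigr => i _ do rewrite minors_set_row big_distrl /=.
      rewrite exchange_big big1 // => b _ /=.
      by under eq_bigr => i _ do rewrite -mulrA; rewrite -big_distrr /= (hc (t, a, b)) mulr0.
    have K01 u : phi (row i0 (v t)) (row i1 (v t)) u = 0.
      rewrite -(T0 i2 u); apply: eq_bigr => i _; congr (minors_tensor _ _ * _).
      by apply/matrixP => a b; move: a; apply: ord3P; rewrite !mxE /= ?mxE.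
    have K02 u : phi (row i0 (v t)) u (row i2 (v t)) = 0.
      rewrite -(T0 i1 u); apply: eq_bigr => i _; congr (minors_tensor _ _ * _).
      by apply/matrixP => a b; move: a; apply: ord3P; rewrite !mxE /= ?mxE.
    have K12 u : phi u (row i1 (v t)) (row i2 (v t)) = 0.
      rewrite -(T0 i0 u); apply: eq_bigr => i _; congr (minors_tensor _ _ * _).
      by apply/matrixP => a b; move: a; apply: ord3P; rewrite !mxE /= ?mxE.
    apply: ord3P; apply: ord3P => u // _.
    - by rewrite (form_swap23 alt) K02 oppr0.
    - by rewrite (form_swap12 alt) K01 oppr0.
    - by rewrite (form_cycle alt).
    - by rewrite (form_swap12 alt) (form_swap23 alt) K02 !oppr0.
    - by rewrite (form_swap12 alt) (form_cycle alt) K12 oppr0.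
  have [e ->] := sum_of_decomposables_all w.
  under eq_bigr => i _ do rewrite tensor_of_sum big_distrl /=.
  rewrite exchange_big big1 // => k _.
  by have := phi0 (row i0 (e k)) (row i1 (e k)) (row i2 (e k)); rewrite /phi /minors_form rows3_row.
exists (fun t => \matrix_(a, b) lam (t, a, b)) => i.
rewrite hlam [RHS]pair_bigA [RHS](eq_bigr _ (fun q _ => minors_set_row _ _ _ _)).
rewrite [RHS]pair_bigA /=; apply: eq_bigr => -[[t a] b] _ /=.
by rewrite !mxE.
Qed.
End Tangent.

(** * Polynomials on the exterior power and dominance *)

Lemma rmorph_mmap (F : comNzRingType) (R S : comNzRingType) (c : {rmorphism F -> R})
    (d : {rmorphism F -> S}) (g : {rmorphism R -> S}) m (h : 'I_m -> R) (q : mpoly m F) :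
  (forall x, g (c x) = d x) -> g (mmap c h q) = mmap d (g \o h) q.
Proof.
move=> gc; rewrite /mmap rmorph_sum; apply: eq_bigr => e _.
rewrite rmorphM gc /mmap1 rmorph_prod; congr (_ * _).
by apply: eq_bigr => i _; rewrite rmorphXn.
Qed.

(** A polynomial in all tensor coordinates may vanish on the skew-symmetric
    tensors without being 0, so nonvanishing is always stated at some point of
    wedge3. *)
Section WedgeSpace.
Variables (F : numFieldType) (N : nat).
Implicit Types (w z : wedge3 F N) (q : mpoly #|{: triple N}| F).

Lemma scale_skew (c : F) w : [ffun i => c * w i] \in @skew_symmetric F N.
Proof.
apply/forallP => i; apply/forallP => s; rewrite !ffunE.
by have /forallP/(_ i)/forallP/(_ s)/eqP -> := valP w; rewrite mulrCA.
Qed.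

Definition wedge_scale c w : wedge3 F N := Wedge3 (scale_skew c w).

Lemma wedge_scaleE c w i : wedge_scale c w i = c * w i.
Proof. by rewrite ffunE. Qed.

Lemma wedge_addE w z i : (w + z) i = w i + z i. Proof. by rewrite ffunE. Qed.
Lemma wedge_subE w z i : (w - z) i = w i - z i. Proof. by rewrite !ffunE. Qed.

Definition wedge_line w z t := w + wedge_scale t (z - w).

Lemma wedge_lineE w z t i : wedge_line w z t i = w i + t * (z i - w i).
Proof. by rewrite wedge_addE wedge_scaleE wedge_subE. Qed.

Lemma wedge_line0 w z : wedge_line w z 0 = w.
Proof. by apply/val_inj/ffunP => i; rewrite [LHS]wedge_lineE mul0r addr0. Qed.

Lemma wedge_line1 w z : wedge_line w z 1 = z.
Proof. by apply/val_inj/ffunP => i; rewrite [LHS]wedge_lineE mul1r addrC subrK. Qed.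

Definition nonzero_on_wedge q := exists w, eval_at q w != 0.

(** The restriction of q to the line through w with direction z. *)
Definition restrict q w (z : triple N -> F) : {poly F} :=
  mmap (@polyC F) (fun k => (w (enum_val k))%:P + 'X * (z (enum_val k))%:P) q.

Lemma horner_restrict q w (z : triple N -> F) t :
  (restrict q w z).[t] = meval (fun k => w (enum_val k) + t * z (enum_val k)) q.
Proof.
rewrite -[LHS]/(horner_eval t _) (@rmorph_mmap _ _ _ _ idfun) => [|x]; last exact: hornerC.
apply: meval_eq => k /=.
by rewrite /horner_eval hornerD hornerM !hornerC hornerX.
Qed.

Lemma nonzero_generic q : nonzero_on_wedge q ->
  generic_on_lines wedge_line (fun w => eval_at q w != 0).
Proof.
move=> nz; split=> // w z t0 h; pose p := restrict q w (fun i => z i - w i).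
have pE t : p.[t] = eval_at q (wedge_line w z t).
  rewrite /p horner_restrict; apply: meval_eq => k.
  by rewrite wedge_lineE.
exists p; last by move=> t; rewrite /root pE.
by apply: contraNneq h => p0; rewrite -pE p0 horner0.
Qed.

Lemma nonzero_on_wedgeM q q' : nonzero_on_wedge q -> nonzero_on_wedge q' ->
  nonzero_on_wedge (q * q').
Proof.
move=> /nonzero_generic h /nonzero_generic h'.
have [[w [hw hw']] _] := generic_on_linesI wedge_line0 wedge_line1 h h'.
by exists w; rewrite /eval_at mevalM mulf_neq0.
Qed.

Lemma generic_nonzero q (P : wedge3 F N -> Prop) : nonzero_on_wedge q ->
  (forall w, eval_at q w != 0 -> P w) -> generic P.
Proof.
move=> [w qw] h; exists [set w | eval_at q w != 0]%classic; split=> //; last by exists w.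
exists [set q]%classic; apply/seteqP; split=> z /=.
  by move=> /negP; rewrite negbK => /eqP hz p ->.
by move=> /(_ q erefl) ->; rewrite eqxx.
Qed.

Lemma genericP (P : wedge3 F N -> Prop) : generic P ->
  exists2 q, nonzero_on_wedge q & forall w, eval_at q w != 0 -> P w.
Proof.
move=> [U [[I hI] [w Uw] UP]].
have : ~ (~` U)%classic w by move=> /(_ Uw).
rewrite hI => /existsNP[q /not_implyP[Iq /eqP qw]]; exists q; first by exists w.
move=> z qz; apply: UP; apply: contrapT => nUz.
have : (~` U)%classic z by []. 
by rewrite hI => /(_ q Iq) /eqP; rewrite (negPf qz).
Qed.

End WedgeSpace.

Section Dominance.
Variables (F : numFieldType) (N s : nat).
Implicit Types (w z : wedge3 F N) (q : mpoly #|{: triple N}| F).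

Definition frame_sum (v : 'I_s -> 'M[F]_(3, N)) : wedge3 F N := \sum_t decomposable (v t).

Lemma frame_sumE v i : frame_sum v i = \sum_t \det (colsub i (v t)).
Proof. by rewrite tensor_of_sum; apply: eq_bigr => t _; rewrite ffunE. Qed.

(** Expand q around y = frame_sum v, and let k be the least order of q along
    the lines through y; choose a direction z that attains it.  Since z is a
    tangent direction, the image contains a curve y + e (z + O(e)), on which q
    is e^k times a nonzero constant plus higher terms.  As q vanishes on the
    curve, this is a contradiction.

    In the proof H(e, d) is q(y + d S(e)), a polynomial in d whose
    coefficients are polynomials in e, where the curve is y + e S(e): the
    coefficients of d^j with j < k vanish because they do so at every e <> 0,
    and the curve is obtained for d = e. *)
Lemma tangent_dominant (v : 'I_s -> 'M[F]_(3, N)) q :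
  (forall w, exists u : 'I_s -> 'M[F]_(3, N), forall i,
    w i = \sum_t \sum_a minors_tensor (set_row (v t) a (row a (u t))) i) ->
  (forall v', eval_at q (frame_sum v') = 0) -> ~ nonzero_on_wedge q.
Proof.
move=> tangents vanish [w1 qw1]; pose y := frame_sum v.
have : exists k, `[< exists z : wedge3 F N, (restrict q y z)`_k != 0 >].
  exists (size (restrict q y (w1 - y))).-1; apply/asboolP; exists (w1 - y).
  rewrite lead_coef_eq0; apply: contraNneq qw1 => /(congr1 (horner^~ 1)).
  rewrite horner_restrict horner0 => <-; apply/eqP/meval_eq => k.
  by rewrite wedge_subE mul1r addrC subrK.
move=> /ex_minnP[k /asboolP[z qz] kmin] {w1 qw1}.
have [u hu] := tangents z.
pose A t (i : triple N) := colsub i (v t); pose B t (i : triple N) := colsub i (u t).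
pose T1 i := \sum_t \sum_a \det (set_row (A t i) a (row a (B t i))).
pose T2 i := \sum_t \sum_a \det (set_row (B t i) a (row a (A t i))).
pose T3 i := \sum_t \det (B t i).
pose S i : {poly F} := (T1 i)%:P + 'X * ((T2 i)%:P + 'X * (T3 i)%:P).
pose path e := frame_sum (fun t => v t + e *: u t).
have pathE e i : path e i = y i + e * (S i).[e].
  have -> : (S i).[e] = T1 i + e * (T2 i + e * T3 i) by rewrite /S !hornerE.
  rewrite /y !frame_sumE /T1 /T2 /T3.
  under eq_bigr => t _.
    rewrite (_ : colsub i _ = A t i + e *: B t i); last by apply/matrixP => a b; rewrite !mxE.
    rewrite det_add_scaled; over.
  rewrite /= big_split /= -big_distrr big_split /= -big_distrr big_split /=.
  by rewrite -big_distrr.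
have S0 i : (S i).[0] = z i.
  rewrite /S !hornerE hu; apply: eq_bigr => t _; apply: eq_bigr => a _.
  rewrite ffunE; congr (\det _).
  by apply/matrixP => b c; rewrite !mxE.
pose H : {poly {poly F}} := mmap (polyC \o polyC)
  (fun k => (y (enum_val k))%:P%:P + 'X * (S (enum_val k))%:P) q.
have coefH j e : (H`_j).[e] = (restrict q y (fun i => (S i).[e]))`_j.
  rewrite -[LHS]/(horner_eval e _) -coef_map /=; congr (_`_j).
  rewrite (@rmorph_mmap _ _ _ _ polyC) => [|x]; last first.
    by rewrite /= map_polyC /= /horner_eval hornerC.
  rewrite /restrict; set h := (_ \o _); suff -> : h = (fun l =>
    (y (enum_val l))%:P + 'X * ((S (enum_val l)).[e])%:P) by [].
  apply/funext => l /=.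
  by rewrite /h /= rmorphD rmorphM /= !map_polyC map_polyX /= /horner_eval hornerC.
have lowH j : (j < k)%N -> H`_j = 0.
  move=> jk; apply: (@poly_eq0_nonroot _ _ 'X); first by rewrite polyX_eq0.
  move=> e; rewrite /root hornerX => e0; rewrite coefH.
  apply/eqP; apply: contraTT jk => ne; rewrite -leqNgt; apply: kmin.
  apply/asboolP; exists (wedge_scale e^-1 (path e - y)).
  rewrite (_ : restrict _ _ _ = restrict q y (fun i => (S i).[e])) //.
  congr (restrict q y _); apply/funext => i.
  by rewrite wedge_scaleE wedge_subE pathE addrAC subrr add0r mulKf.
(* At e = 0 the direction S(e) is z, for which the order is exactly k. *)
have topH : (H`_k).[0] != 0.
  by rewrite coefH (_ : (fun i => _) = z) //; apply/funext.
(* Substituting e for d gives q along the curve. *)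
have HX : H.['X] = 0.
  apply: poly_eq0_all => e.
  rewrite -[LHS]/((horner_eval e \o horner_eval 'X) H).
  rewrite (@rmorph_mmap _ _ _ _ idfun) => [|x]; last first.
    by rewrite /= /horner_eval !hornerC.
  rewrite -(vanish (fun t => v t + e *: u t)); apply: meval_eq => l /=.
  by rewrite -/(path e) pathE /horner_eval !hornerE.
have := congr1 (fun p : {poly F} => p`_k) HX; rewrite horner_coef coef_sum coef0.
have kH : (k < size H)%N.
  by rewrite ltnNge; apply: contra topH => /leq_sizeP/(_ k (leqnn k)) ->; rewrite horner0.
rewrite (bigD1 (Ordinal kH)) //= coefMXn ltnn subnn big1 => [|j ne].
  by rewrite addr0 -horner_coef0; apply/eqP.
rewrite coefMXn; case: ltnP => // jk.
by rewrite lowH ?coef0 // ltn_neqAle jk andbT.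
Qed.
End Dominance.

(** * The image contains an open set *)

Section GenericFormulas.
Variables (F : numFieldType) (N : nat).
Implicit Types (w : wedge3 F N) (q : mpoly #|{: triple N}| F).

Definition coordinates w : seq F := [seq w i | i <- enum {: triple N}].

Lemma nth_coordinates w i : (coordinates w)`_(enum_rank i) = w i.
Proof. by rewrite (nth_map i) ?nth_enum_rank // -cardE ltn_ord. Qed.

Lemma size_coordinates w : size (coordinates w) = #|{: triple N}|.
Proof. by rewrite size_map -cardT. Qed.

Lemma term_polynomial (t : GRing.term F) : GRing.rterm t ->
  exists q, forall w, GRing.eval (coordinates w) t = eval_at q w.
Proof.
elim: t => //=.
- move=> k _; have [lt|ge] := ltnP k #|{: triple N}|; last first.
    by exists 0 => w; rewrite /eval_at meval0 nth_default // size_coordinates.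
  exists (mpolyX F (mnm1 (Ordinal lt))) => w; rewrite /eval_at mevalXU.
  by rewrite -nth_coordinates enum_valK.
- by move=> c _; exists (mpolyC _ c) => w; rewrite /eval_at mevalC.
- by move=> k _; exists k%:R => w; rewrite /eval_at rmorph_nat.
- move=> t1 h1 t2 h2 /andP[/h1[q1 e1] /h2[q2 e2]]; exists (q1 + q2) => w.
  by rewrite e1 e2 /eval_at mevalD.
- by move=> t1 h1 /h1[q1 e1]; exists (- q1) => w; rewrite e1 /eval_at mevalN.
- by move=> t1 h1 k /h1[q1 e1]; exists (q1 *+ k) => w; rewrite e1 /eval_at mevalMn.
- move=> t1 h1 t2 h2 /andP[/h1[q1 e1] /h2[q2 e2]]; exists (q1 * q2) => w.
  by rewrite e1 e2 /eval_at mevalM.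
- by move=> t1 h1 k /h1[q1 e1]; exists (q1 ^+ k) => w; rewrite e1 /eval_at rmorphXn.
Qed.

Lemma nonzero_on_wedge1 : nonzero_on_wedge (1 : mpoly #|{: triple N}| F).
Proof. by exists 0; rewrite /eval_at meval1 oner_neq0. Qed.

(** An equation between polynomials is either an identity on wedge3 or false on
    a nonempty open set, and nonempty open sets of wedge3 meet. *)
Lemma qf_generically_constant (f : GRing.formula F) : GRing.qf_form f -> GRing.rformula f ->
  exists (b : bool) q, nonzero_on_wedge q /\
    forall w, eval_at q w != 0 -> GRing.qf_eval (coordinates w) f = b.
Proof.
elim: f => //=.
- by move=> b _ _; exists b, 1; split=> //; exact: nonzero_on_wedge1.
- move=> t1 t2 _ /andP[/term_polynomial[q1 e1] /term_polynomial[q2 e2]].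
  have [nz|z] := pselect (nonzero_on_wedge (q1 - q2)).
    exists false, (q1 - q2); split=> // w; rewrite /eval_at mevalB subr_eq0.
    by rewrite e1 e2 => /negPf.
  exists true, 1; split=> [|w _]; first exact: nonzero_on_wedge1.
  rewrite e1 e2 -subr_eq0 -mevalB; apply/negPn/negP => ne.
  by apply: z; exists w.
- move=> f1 h1 f2 h2 /andP[q1 q2] /andP[r1 r2].
  have [b1 [p1 [n1 e1]]] := h1 q1 r1; have [b2 [p2 [n2 e2]]] := h2 q2 r2.
  exists (b1 && b2), (p1 * p2); split=> [|w]; first exact: nonzero_on_wedgeM.
  by rewrite /eval_at mevalM mulf_eq0 negb_or => /andP[/e1 -> /e2 ->].
- move=> f1 h1 f2 h2 /andP[q1 q2] /andP[r1 r2].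
  have [b1 [p1 [n1 e1]]] := h1 q1 r1; have [b2 [p2 [n2 e2]]] := h2 q2 r2.
  exists (b1 || b2), (p1 * p2); split=> [|w]; first exact: nonzero_on_wedgeM.
  by rewrite /eval_at mevalM mulf_eq0 negb_or => /andP[/e1 -> /e2 ->].
- move=> f1 h1 f2 h2 /andP[q1 q2] /andP[r1 r2].
  have [b1 [p1 [n1 e1]]] := h1 q1 r1; have [b2 [p2 [n2 e2]]] := h2 q2 r2.
  exists (b1 ==> b2), (p1 * p2); split=> [|w]; first exact: nonzero_on_wedgeM.
  by rewrite /eval_at mevalM mulf_eq0 negb_or => /andP[/e1 -> /e2 ->].
- move=> f1 h1 q1 r1; have [b1 [p1 [n1 e1]]] := h1 q1 r1.
  by exists (~~ b1), p1; split=> // w /e1 ->.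
Qed.
End GenericFormulas.

Section Image.
Variables (F : numClosedFieldType) (N s : nat).
Local Notation P := #|{: triple N}|.
Local Notation V := ('I_s * 'I_3 * 'I_N)%type.

(** The variables below P are the coordinates of the tensor; those above are
    the entries of the frames. *)
Definition frame_var (q : V) : GRing.term F := GRing.Var F (P + enum_rank q).

Definition det_term (E : 'I_3 -> 'I_3 -> GRing.term F) : GRing.term F :=
  (E i0 i0 * E i1 i1 * E i2 i2 + E i0 i1 * E i1 i2 * E i2 i0
  + E i0 i2 * E i1 i0 * E i2 i1 - E i0 i2 * E i1 i1 * E i2 i0
  - E i0 i1 * E i1 i0 * E i2 i2 - E i0 i0 * E i1 i2 * E i2 i1)%T.

Lemma eval_det_term e E : GRing.eval e (det_term E) = \det (\matrix_(a, b) GRing.eval e (E a b)).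
Proof. by rewrite det_mx33 !mxE. Qed.

Definition coordinate_term (i : triple N) : GRing.term F :=
  \big[GRing.Add/GRing.Const 0]_(t < s) det_term (fun a b => frame_var (t, a, i b)).

Definition image_formula : GRing.formula F :=
  \big[GRing.And/GRing.Bool true]_(i : triple N)
     (GRing.Var F (enum_rank i) == coordinate_term i)%T.

Lemma holds_big_and (I : finType) e (f : I -> GRing.formula F) :
  GRing.holds e (\big[GRing.And/GRing.Bool true]_i f i) <-> forall i, GRing.holds e (f i).
Proof.
suff h (l : seq I) : GRing.holds e (\big[GRing.And/GRing.Bool true]_(i <- l) f i) <->
    forall i, i \in l -> GRing.holds e (f i).
  by rewrite h; split=> hf i; [apply: hf; rewrite mem_index_enum|move=> _; apply: hf].
elim: l => [|i l IH]; first by rewrite big_nil.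
rewrite big_cons /= IH; split=> [[hi hl] j|hf]; first by rewrite inE => /predU1P[->|/hl].
by split=> [|j jl]; apply: hf; rewrite inE ?eqxx ?jl ?orbT.
Qed.

Lemma image_formula_rformula : GRing.rformula image_formula.
Proof.
rewrite /image_formula; elim/big_rec: _ => //= i f _ ->; rewrite andbT.
by rewrite /coordinate_term; elim/big_rec: _ => //= t u _ ->.
Qed.

Lemma holds_image_formula e : GRing.holds e image_formula <->
  forall i : triple N, e`_(enum_rank i) =
    \sum_(t < s) \det (\matrix_(a, b) e`_(P + enum_rank (t, a, i b : 'I_N))).
Proof.
rewrite holds_big_and; split=> h i; have := h i.
  move=> /= ->; rewrite /coordinate_term (big_morph (GRing.eval e) (id1 := 0) (op1 := +%R)) //.
  by apply: eq_bigr => t _; rewrite eval_det_term.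
move=> /= ->; rewrite /coordinate_term (big_morph (GRing.eval e) (id1 := 0) (op1 := +%R)) //.
by apply: eq_bigr => t _; rewrite eval_det_term.
Qed.

Definition exists_frames : GRing.formula F :=
  foldr GRing.Exists image_formula [seq (P + enum_rank q)%N | q : V].

Lemma exists_framesP (w : wedge3 F N) :
  GRing.holds (coordinates w) exists_frames <-> exists v : 'I_s -> 'M[F]_(3, N), w = frame_sum v.
Proof.
have out (i : triple N) : nat_of_ord (enum_rank i) \notin [seq (P + enum_rank q)%N | q : V].
  by apply/negP => /codomP[q /= e]; have := ltn_ord (enum_rank i); rewrite e ltnNge leq_addr.
rewrite /exists_frames; split.
  case/GRing.foldExistsP => e' same /holds_image_formula he.
  exists (fun t => \matrix_(a, c) e'`_(P + enum_rank (t, a, c))).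
  apply/val_inj/ffunP => i; rewrite [RHS]frame_sumE -nth_coordinates.
  rewrite (same (enum_rank i)) ?he ?inE ?out //.
  by apply: eq_bigr => t _; congr (\det _); apply/matrixP => a b; rewrite !mxE.
move=> [v ->]; apply/GRing.foldExistsP.
pose e' := coordinates (frame_sum v) ++ [seq v q.1.1 q.1.2 q.2 | q : V].
have e'w (i : triple N) : e'`_(enum_rank i) = frame_sum v i.
  by rewrite nth_cat size_coordinates ltn_ord nth_coordinates.
have e'v (q : V) : e'`_(P + enum_rank q) = v q.1.1 q.1.2 q.2.
  rewrite nth_cat size_coordinates ltnNge leq_addr /= addKn (nth_map q) ?nth_enum_rank //.
  by rewrite -cardE ltn_ord.
exists e'.
  move=> k; rewrite inE => /negP nk.
  have [lt|ge] := ltnP k P.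
    by rewrite -[k]/(val (Ordinal lt)) -[Ordinal lt]enum_valK e'w nth_coordinates.
  have [lt|ge'] := ltnP (k - P) #|{: V}|.
    case: nk; apply/codomP; exists (enum_val (Ordinal lt)).
    by rewrite enum_valK /= subnKC.
  rewrite !nth_default ?size_coordinates // size_cat size_coordinates size_map -cardT.
  by rewrite -leq_subRL.
apply/holds_image_formula => i; rewrite e'w frame_sumE; apply: eq_bigr => t _.
by congr (\det _); apply/matrixP => a b; rewrite !mxE e'v.
Qed.

(** Chevalley's theorem in the case at hand.  The quantifier-free formula that
    defines the image is generically constant; it is not generically false,
    since the image would then lie in the zero set of a polynomial. *)
Lemma dominant_generic :
  (forall q, (forall v : 'I_s -> 'M[F]_(3, N), eval_at q (frame_sum v) = 0) ->
     ~ nonzero_on_wedge q) ->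
  generic (fun w : wedge3 F N => exists v : 'I_s -> 'M[F]_(3, N), w = frame_sum v).
Proof.
move=> dom.
pose g := GRing.quantifier_elim (@ClosedFieldQE.ex_elim F) exists_frames.
have rf : GRing.rformula exists_frames.
  by rewrite /exists_frames; elim: (X in foldr _ _ X) => //; exact: image_formula_rformula.
have wf := @ClosedFieldQE.wf_ex_elim F.
have ok := @ClosedFieldQE.holds_ex_elim F (@solve_monicpoly F).
have gP w : reflect (exists v : 'I_s -> 'M[F]_(3, N), w = frame_sum v)
    (GRing.qf_eval (coordinates w) g).
  by apply: (iffP (GRing.quantifier_elim_rformP wf ok _ rf)) => /exists_framesP.
have /andP[qg rg] := GRing.quantifier_elim_wf wf rf.
have [[] [q [nz hq]]] := qf_generically_constant N qg rg.
  by apply: (generic_nonzero nz) => w /hq/gP.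
case: (dom q) => // v; apply/eqP/negPn/negP => /hq /gP; apply; by exists v.
Qed.
End Image.

(** * Parameter count *)

Section SeparateDegree.
Variables (F : numFieldType) (V : finType).
Implicit Types (x : V -> F) (f g : (V -> F) -> F).

Definition update x i t : V -> F := fun j => if j == i then t else x j.

(** Degree at most d in each variable separately.  Stated for functions, so
    that composing the parametrization with a polynomial needs no substitution
    of polynomials in several variables. *)
Definition separate_degree_le d f := forall x i,
  exists2 p : {poly F}, (size p <= d.+1)%N & forall t, f (update x i t) = p.[t].

Lemma separate_degree_const d c : separate_degree_le d (fun=> c).
Proof.
move=> x i; exists c%:P; last by move=> t; rewrite hornerC.
by rewrite size_polyC; case: eqP.
Qed.

Lemma separate_degree_var i : separate_degree_le 1 (fun x => x i).
Proof.
move=> x j; have [->|ne] := eqVneq i j.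
  by exists 'X; rewrite ?size_polyX // => t; rewrite hornerX /update eqxx.
exists (x i)%:P; first by rewrite size_polyC; case: eqP.
by move=> t; rewrite hornerC /update (negPf ne).
Qed.

Lemma separate_degreeD d f g : separate_degree_le d f -> separate_degree_le d g ->
  separate_degree_le d (fun x => f x + g x).
Proof.
move=> hf hg x i; have [p sp pE] := hf x i; have [q sq qE] := hg x i.
exists (p + q); last by move=> t; rewrite hornerD pE qE.
by rewrite (leq_trans (size_polyD _ _)) // geq_max sp sq.
Qed.

Lemma separate_degreeM d e f g : separate_degree_le d f -> separate_degree_le e g ->
  separate_degree_le (d + e) (fun x => f x * g x).
Proof.
move=> hf hg x i; have [p sp pE] := hf x i; have [q sq qE] := hg x i.
exists (p * q); last by move=> t; rewrite hornerM pE qE.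
by rewrite (leq_trans (size_polyMleq _ _)) //; lia.
Qed.

Lemma separate_degreeN d f : separate_degree_le d f -> separate_degree_le d (fun x => - f x).
Proof.
move=> hf x i; have [p sp pE] := hf x i.
by exists (- p) => [|t]; rewrite ?size_polyN ?hornerN ?pE.
Qed.

Lemma separate_degreeW d e f : (d <= e)%N -> separate_degree_le d f -> separate_degree_le e f.
Proof. by move=> de hf x i; have [p sp pE] := hf x i; exists p => //; apply: leq_trans sp _. Qed.

Lemma separate_degree_sum d (I : Type) (l : seq I) (f : I -> (V -> F) -> F) :
  (forall i, separate_degree_le d (f i)) ->
  separate_degree_le d (fun x => \sum_(i <- l) f i x).
Proof.
move=> hf; elim: l => [|i l IH].
  by move=> x i; have [p sp pE] := separate_degree_const d 0 x i;
     exists p => // t; rewrite big_nil -pE.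
move=> x j; have [p sp pE] := separate_degreeD (hf i) IH x j.
by exists p => // t; rewrite big_cons -pE.
Qed.

Lemma separate_degreeX d k f : separate_degree_le d f ->
  separate_degree_le (k * d) (fun x => f x ^+ k).
Proof.
move=> hf; elim: k => [|k IH] x i.
  have [p sp pE] := separate_degree_const 0 1 x i.
  by exists p => [|t]; rewrite ?mul0n // expr0 -pE.
have [p sp pE] := separate_degreeM hf IH x i.
by exists p => [|t]; rewrite ?mulSn // exprS -pE.
Qed.

Lemma separate_degree_prod (I : Type) (l : seq I) (d : I -> nat) (f : I -> (V -> F) -> F) :
  (forall i, separate_degree_le (d i) (f i)) ->
  separate_degree_le (\sum_(i <- l) d i) (fun x => \prod_(i <- l) f i x).
Proof.
move=> hf; elim: l => [|i l IH] x j.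
  have [p sp pE] := separate_degree_const 0 1 x j.
  by exists p => [|t]; rewrite ?big_nil // -pE.
have [p sp pE] := separate_degreeM (hf i) IH x j.
by exists p => [|t]; rewrite ?big_cons // -pE.
Qed.

(** The variables are released one at a time from the grid: in each of them the
    function is a polynomial of degree at most d with d + 1 roots. *)
Lemma vanish_on_grid d f : separate_degree_le d f ->
  (forall g : {ffun V -> 'I_d.+1}, f (fun i => (g i)%:R) = 0) -> forall x, f x = 0.
Proof.
move=> hf grid.
suff h (l : seq V) : forall x, (forall i, i \notin l -> exists k : 'I_d.+1, x i = k%:R) ->
    f x = 0.
  by move=> x; apply: (h (enum V)) => i; rewrite mem_enum.
elim: l => [|i l IH] x hx.
  have /choice[g hg] : forall i, exists k : 'I_d.+1, x i = k%:R by move=> i; apply: hx.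
  by rewrite -(grid (finfun g)); congr f; apply/funext => i; rewrite ffunE.
have [p sp pE] := hf x i.
have <- : update x i (x i) = x.
  by apply/funext => j; rewrite /update; case: eqP => // ->.
rewrite pE; suff -> : p = 0 by rewrite horner0.
apply/eqP; apply: contraLR sp => p0; rewrite -ltnNge.
pose s : seq F := [seq n%:R | n <- iota 0 d.+1].
rewrite -[d.+1](size_iota 0) -(size_map (fun n => n%:R : F)) max_poly_roots //.
  apply/allP => t /mapP[k]; rewrite mem_iota add0n => /andP[_ lt] ->.
  apply/eqP; rewrite -pE; apply: IH => j jl; rewrite /update.
  have [_|ji] := eqVneq j i; first by exists (Ordinal lt).
  by apply: hx; rewrite inE negb_or ji.
by rewrite map_inj_uniq ?iota_uniq // => m n /eqP; rewrite eqr_nat => /eqP.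
Qed.
End SeparateDegree.

Lemma row_relation (F : fieldType) (I J : finType) (M : I -> J -> F) :
  (#|J| < #|I|)%N ->
  exists c : I -> F, (exists i, c i != 0) /\ forall j, \sum_i c i * M i j = 0.
Proof.
move=> lt; pose A := \matrix_(i < #|I|, j < #|J|) M (enum_val i) (enum_val j).
have /rowV0Pn[c /sub_kermxP cA c0] : kermx A != 0.
  by rewrite kermx_eq0 /row_free ltn_eqF // (leq_ltn_trans (rank_leq_col A) lt).
exists (fun i => c 0 (enum_rank i)); split.
  have /rV0Pn[k ck] := c0; exists (enum_val k); by rewrite enum_valK.
move=> j; have : (c *m A) 0 (enum_rank j) = 0 by rewrite cA mxE.
rewrite mxE => hz; rewrite -[RHS]hz -(sum_enum_val (fun i => c 0 (enum_rank i) * M i j)).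
by apply: eq_bigr => k _; rewrite [A _ _]mxE enum_valK enum_rankK.
Qed.

Definition digit (D k m : nat) := (k %/ D ^ m %% D)%N.

Lemma sum_digits D b k : (0 < D)%N -> (\sum_(m < b) digit D k m * D ^ m = k %% D ^ b)%N.
Proof.
move=> D0; elim: b => [|b IH]; first by rewrite big_ord0 modn1.
rewrite big_ord_recr /= IH /digit.
set q := (k %/ D ^ b)%N.
have kE : k = (q %/ D * D ^ b.+1 + (q %% D * D ^ b + k %% D ^ b))%N.
  by rewrite addnA expnS mulnA -mulnDl -divn_eq -divn_eq.
rewrite [in RHS]kE modnMDl (@modn_small (_ + _)); first by rewrite addnC.
have Db : (0 < D ^ b)%N by rewrite expn_gt0 D0.
apply: leq_trans (_ : ((q %% D).+1 * D ^ b <= _)%N).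
  by rewrite mulSn addnC ltn_add2r ltn_mod.
by rewrite expnS leq_mul2r ltn_mod D0 orbT.
Qed.

Section ParameterCount.
Variables (F : numFieldType) (n s : nat).
Local Notation N := n.+1.
Local Notation V := ('I_s * 'I_3 * 'I_N)%type.
Local Notation b := 'C(N, 3).

(** The subsets with three elements index the independent coordinates of
    wedge3. *)
Definition three_set (m : 'I_b) : {set 'I_N} :=
  nth finset.set0 (enum [set A : {set 'I_N} | #|A| == 3%N]) m.

Lemma card_three_set m : #|three_set m| = 3%N.
Proof.
have : three_set m \in enum [set A : {set 'I_N} | #|A| == 3%N].
  by rewrite mem_nth // -cardE card_draws card_ord.
by rewrite mem_enum inE => /eqP.
Qed.

Lemma three_set_inj : injective three_set.
Proof.
move=> m m' /eqP; rewrite nth_uniq ?enum_uniq -?cardE ?card_draws ?card_ord ?ltn_ord //.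
by move=> /eqP/val_inj.
Qed.

Definition basis_triple (m : 'I_b) : triple N := [ffun a : 'I_3 => nth ord0 (enum (three_set m)) a].

Lemma mem_basis_triple m a : basis_triple m a \in three_set m.
Proof. by rewrite ffunE -mem_enum mem_nth // -cardE card_three_set. Qed.

Lemma basis_triple_inj m : injective (basis_triple m).
Proof.
move=> a a'; rewrite !ffunE => /eqP; rewrite nth_uniq ?enum_uniq -?cardE ?card_three_set //.
by move=> /eqP/val_inj.
Qed.

Definition basis_wedge m : wedge3 F N :=
  decomposable (\matrix_(a, c) (basis_triple m a == c)%:R).

Lemma basis_wedgeE m m' : basis_wedge m (basis_triple m') = (m == m')%:R.
Proof.
rewrite ffunE; have [<-|ne] := eqVneq m m'.
  rewrite (_ : colsub _ _ = 1%:M) ?det1 //; apply/matrixP => a c; rewrite !mxE.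
  by rewrite (inj_eq (@basis_triple_inj m)).
have [a ha] : exists a, basis_triple m a \notin three_set m'.
  apply: contrapT => /forallNP h; case/eqP: ne; apply: three_set_inj.
  apply/eqP; rewrite eqEcard !card_three_set leqnn andbT.
  apply/fintype.subsetP => c; rewrite -mem_enum => cm.
  have lt : (index c (enum (three_set m)) < 3)%N.
    by rewrite -(card_three_set m) cardE index_mem.
  have /negP := h (Ordinal lt); rewrite negbK ffunE /= nth_index //.
rewrite (expand_det_row _ a) big1 // => c _; rewrite !mxE.
case: eqP => [e|_]; last by rewrite mul0r.
by case/negP: ha; rewrite e mem_basis_triple.
Qed.

Definition matrices (x : V -> F) (t : 'I_s) : 'M[F]_(3, N) := \matrix_(a, c) x (t, a, c).

Lemma frame_sum_degree (i : triple N) :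
  separate_degree_le 3 (fun x => frame_sum (matrices x) i).
Proof.
pose f t (x : V -> F) := let e a c := x (t, a, i c) in
    e i0 i0 * e i1 i1 * e i2 i2 + e i0 i1 * e i1 i2 * e i2 i0
  + e i0 i2 * e i1 i0 * e i2 i1 - e i0 i2 * e i1 i1 * e i2 i0
  - e i0 i1 * e i1 i0 * e i2 i2 - e i0 i0 * e i1 i2 * e i2 i1.
have fE x : frame_sum (matrices x) i = \sum_t f t x.
  by rewrite frame_sumE; apply: eq_bigr => t _; rewrite det_mx33 !mxE.
have mono (q1 q2 q3 : V) : separate_degree_le 3 (fun x : V -> F => x q1 * x q2 * x q3).
  by apply: (@separate_degreeM _ _ 2 1); [apply: (@separate_degreeM _ _ 1 1)|];
     exact: separate_degree_var.
have hf t : separate_degree_le 3 (f t).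
  by do !(apply: separate_degreeD || apply: separate_degreeN || apply: mono).
move=> x j; have [p sp pE] := separate_degree_sum (index_enum _) hf x j.
by exists p => // t; rewrite fE.
Qed.

(** Let a be the number of entries of the frames.  There are D^b monomials with
    exponents below D in the b coordinates.  As functions of the entries of
    the frames they have degree at most d = 3b(D-1) in each variable, so they
    are determined by their values at (d+1)^a points.  For D > (3b)^a this is
    less than D^b because a < b, and a linear relation between the monomials
    results.

    The monomials are numbered by the integers k < D^b, the exponents being the
    digits of k in base D: substituting z^(D^m) for the coordinate m turns
    monomial k into z^k, which shows that the relation is a nonzero
    polynomial. *)
Lemma parameter_count : (#|{: V}| < b)%N ->
  exists2 q : mpoly #|{: triple N}| F, nonzero_on_wedge q &
    forall v : 'I_s -> 'M[F]_(3, N), eval_at q (frame_sum v) = 0.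
Proof.
set a := #|{: V}| => ab.
pose D := ((3 * b) ^ a).+1; pose d := (b * (3 * D.-1))%N.
have b0 : (0 < b)%N by apply: leq_ltn_trans ab.
pose mon (k : 'I_(D ^ b)) (w : wedge3 F N) := \prod_(m < b) w (basis_triple m) ^+ digit D k m.
have [c [[k0 ck0] hc]] : exists c : 'I_(D ^ b) -> F, (exists k, c k != 0) /\
    forall g : {ffun V -> 'I_d.+1},
      \sum_k c k * mon k (frame_sum (matrices (fun i => (g i)%:R))) = 0.
  apply: row_relation; rewrite card_ffun !card_ord -/a.
  apply: leq_ltn_trans (_ : ((3 * b * D) ^ a < _)%N).
    have le : (d.+1 <= 3 * b * D)%N.
      by rewrite /d /D /= mulnS mulnCA mulnA -add1n leq_add2r muln_gt0 b0.
    by have [->|a0] := posnP a; rewrite ?expn0 // leq_exp2r.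
  rewrite expnMn; apply: leq_trans (_ : (D ^ a.+1 <= _)%N); last first.
    by rewrite leq_exp2l // ltnS expn_gt0 muln_gt0 b0.
  by rewrite expnS ltn_mul2r expn_gt0 ltnSn.
pose q : mpoly #|{: triple N}| F := \sum_k mpolyC _ (c k) *
  \prod_(m < b) (mpolyX F (mnm1 (enum_rank (basis_triple m)))) ^+ digit D k m.
have qE w : eval_at q w = \sum_k c k * mon k w.
  rewrite /eval_at /q raddf_sum; apply: eq_bigr => k _ /=.
  rewrite mevalM mevalC rmorph_prod; congr (_ * _); apply: eq_bigr => m _.
  by rewrite rmorphXn /= mevalXU enum_rankK.
exists q.
  have [z hz] : exists z, ~~ root (\poly_(k < D ^ b) oapp c 0 (insub k)) z.
    apply: poly_nonroot; apply: contraNneq ck0 => /(congr1 (fun p : {poly F} => p`_k0)).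
    by rewrite coef_poly ltn_ord coef0 valK /= => ->.
  pose w : wedge3 F N := \sum_(m < b) wedge_scale (z ^+ (D ^ m)) (basis_wedge m).
  have wE m : w (basis_triple m) = z ^+ (D ^ m).
    rewrite tensor_of_sum (bigD1 m) // wedge_scaleE basis_wedgeE eqxx mulr1.
    rewrite big1 => [|m' /negPf ne]; first by rewrite /= addr0.
    by rewrite wedge_scaleE basis_wedgeE ne mulr0.
  exists w; apply: contra hz => /eqP hz; apply/eqP; rewrite -[RHS]hz qE horner_poly.
  apply: eq_bigr => k _; rewrite valK /=; congr (_ * _).
  rewrite /mon; under eq_bigr => m _ do rewrite wE -exprM mulnC.
  by rewrite /= -expr_sum sum_digits // modn_small.
move=> v; pose x0 (p : V) := v p.1.1 p.1.2 p.2.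
have -> : v = matrices x0 by apply/funext => t; apply/matrixP => i j; rewrite mxE.
move: x0; apply: (@vanish_on_grid _ _ d); last by move=> g; rewrite qE hc.
have hsum : separate_degree_le d (fun x => \sum_k c k * mon k (frame_sum (matrices x))).
  apply: separate_degree_sum => k; rewrite -[d]add0n.
  apply: (@separate_degreeM _ _ 0 d); first exact: separate_degree_const.
  have := separate_degree_prod (index_enum _)
    (fun m : 'I_b => separate_degreeX (digit D k m) (frame_sum_degree (basis_triple m))).
  apply: separate_degreeW; rewrite /d.
  rewrite -[X in (X * _)%N](card_ord b) -sum_nat_const; apply: leq_sum => m _.
  by rewrite mulnC leq_mul2l /= -ltnS /digit ltn_mod.
by move=> x i; have [p sp pE] := hsum x i; exists p => // t; rewrite qE pE.
Qed.

Lemma decomposable0 : decomposable 0 = 0 :> wedge3 F N.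
Proof.
apply/val_inj/ffunP => i; rewrite !ffunE (expand_det_row _ i0) big1 // => j _.
by rewrite !mxE mul0r.
Qed.

Lemma tensor_rank_frames (w : wedge3 F N) : (tensor_rank w <= s)%N ->
  exists v : 'I_s -> 'M[F]_(3, N), w = frame_sum v.
Proof.
rewrite /tensor_rank; case: ex_minnP => r /asboolP[v ->] _ rs.
exists (fun t => oapp v 0 (insub (val t))).
rewrite /frame_sum [RHS](bigID (fun t : 'I_s => t < r)%N) /= [X in _ + X]big1; last first.
  by move=> t nt; rewrite insubN // decomposable0.
rewrite addr0 (big_ord_narrow rs); apply: eq_bigr => t _.
by rewrite /= valK.
Qed.

Lemma generic_rank_lower_bound :
  generic (fun w : wedge3 F N => (tensor_rank w <= s)%N) -> (b <= s * 3 * N)%N.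
Proof.
move=> /genericP[p p0 hp]; rewrite leqNgt; apply/negP => lt.
have [|q q0 hq] := parameter_count; first by rewrite !card_prod !card_ord.
have [w] := nonzero_on_wedgeM p0 q0; rewrite /eval_at mevalM mulf_eq0 negb_or.
move=> /andP[/hp/tensor_rank_frames[v wE] qw].
by move: (hq v) qw; rewrite -wE /eval_at => ->; rewrite eqxx.
Qed.
End ParameterCount.

(** * The typical rank *)

Lemma typical_rank_le (F : numFieldType) n s :
  generic (fun w : wedge3 F n.+1 => (tensor_rank w <= s)%N) -> (typical_rank F n <= s)%N.
Proof. by rewrite /typical_rank; case: ex_minnP => T _ + /asboolP; apply. Qed.

Lemma typical_rank_generic (F : numFieldType) n :
  generic (fun w : wedge3 F n.+1 => (tensor_rank w <= typical_rank F n)%N).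
Proof. by rewrite /typical_rank; case: ex_minnP => T /asboolP. Qed.

Lemma typical_rank_upper (F : numClosedFieldType) (n K r : nat) :
  (3 * r ^ 2 + 3 <= K.+1)%N -> (n.+1 <= K.+1 * (r * 3))%N ->
  (6 * typical_rank F n <= K.+1 ^ 2 * (3 * r ^ 2 + 3) + 54 * (r ^ 2 * K.+1))%N.
Proof.
move=> design_fits space_fits.
have [vs [size_vs sep]] := separating_frames F design_fits space_fits.
apply: leq_trans size_vs; rewrite leq_mul2l /=; apply: typical_rank_le.
pose v (t : 'I_(size vs)) := nth 0 vs t.
have tangents : forall w : wedge3 F n.+1, exists u : 'I_(size vs) -> 'M[F]_(3, n.+1),
    forall i, w i = \sum_t \sum_a minors_tensor (set_row (v t) a (row a (u t))) i.
  apply: tangents_span => phi alt kill; apply: (sep phi alt) => m /(nthP 0)[k lt <-].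
  exact: (kill (Ordinal lt)).
have [U [openU neU UP]] := dominant_generic (fun q => tangent_dominant (q := q) tangents).
exists U; split=> // w /UP[u ->]; rewrite /tensor_rank; case: ex_minnP => k _; apply.
by apply/asboolP; exists u.
Qed.

Lemma typical_rank_lower (F : numFieldType) n : (n ^ 2 <= 18 * typical_rank F n + n)%N.
Proof.
have := generic_rank_lower_bound (typical_rank_generic F n).
move: (typical_rank F n) => T le.
have : (6 * 'C(n.+1, 3) = n.+1 * n * n.-1)%N.
  by rewrite -[6%N]/(3`!) mulnC bin_ffact !ffactnS ffactn0 muln1 mulnA.
case: n le => [|n] le e //=; rewrite -mulnn.
have : (n.+2 * (n.+1 * n) <= n.+2 * (18 * T))%N by move: le e => /=; nia.
by rewrite leq_pmul2l //; lia.
Qed.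

(** The number k = K + 1 of summands is the least with n + 1 < 3rk; the hypothesis
    that n is large makes room for the 3r^2 + 3 sums of the design. *)
Lemma typical_rank_upper_eventually (F : numClosedFieldType) (r : nat) : (0 < r)%N ->
  exists C n0, forall n, (n0 <= n)%N ->
    (18 * r ^ 2 * typical_rank F n <= (r ^ 2 + 1) * n ^ 2 + C * n)%N.
Proof.
move=> r0; pose m := (1 + 3 * r)%N.
exists ((r ^ 2 + 1) * (2 * m + m ^ 2) + 54 * r ^ 3 * (1 + m))%N.
exists (3 * r * (3 * r ^ 2 + 3)).+1%N => n n0.
pose K := (n.+1 %/ (3 * r))%N.
have r3 : (0 < 3 * r)%N by rewrite muln_gt0.
have n1 : (0 < n)%N by apply: leq_trans n0.
have kM : (3 * r * K.+1 <= n + m)%N.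
  by have := leq_trunc_div n.+1 (3 * r); rewrite -/K /m; lia.
have kn : (n.+1 <= K.+1 * (r * 3))%N.
  by rewrite (mulnC r) ltnW // ltn_ceil.
have kS : (3 * r ^ 2 + 3 <= K.+1)%N.
  by apply: ltnW; rewrite ltnS leq_divRL // mulnC; lia.
have := typical_rank_upper F kS kn; move: (typical_rank F n) (K.+1) kM => T k kM h.
have e : (18 * r ^ 2 * T <= (r ^ 2 + 1) * (3 * r * k) ^ 2 + 54 * r ^ 3 * (3 * r * k))%N.
  have -> : (18 * r ^ 2 * T = 3 * r ^ 2 * (6 * T))%N by lia.
  have -> : ((r ^ 2 + 1) * (3 * r * k) ^ 2 + 54 * r ^ 3 * (3 * r * k) =
     3 * r ^ 2 * (k ^ 2 * (3 * r ^ 2 + 3) + 54 * (r ^ 2 * k)))%N by ring.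
  by rewrite leq_mul2l h orbT.
apply: leq_trans e _.
apply: leq_trans (_ : (r ^ 2 + 1) * (n + m) ^ 2 + 54 * r ^ 3 * (n + m) <= _)%N.
  by rewrite leq_add ?leq_mul2l ?leq_sqr ?kM ?orbT.
have mn : (m <= m * n)%N by rewrite leq_pmulr.
have h1 : ((n + m) ^ 2 <= n ^ 2 + (2 * m + m ^ 2) * n)%N.
  by have := leq_mul (leqnn m) mn; nia.
have h2 : (n + m <= (1 + m) * n)%N by rewrite mulnDl mul1n leq_add2l.
rewrite [X in (_ <= X)%N](_ : _ = (r ^ 2 + 1) * (n ^ 2 + (2 * m + m ^ 2) * n)
    + 54 * r ^ 3 * ((1 + m) * n))%N; last by ring.
by rewrite leq_add // leq_mul2l ?h1 ?h2 orbT.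
Qed.

(** The error 1/r^2 is made at most e/2 by the choice of r, and C/n at most
    e/2 for large n. *)
Lemma ratio_cvg (R : realType) (T : nat -> nat) :
  (forall n, n ^ 2 <= 18 * T n + n)%N ->
  (forall r, (0 < r)%N -> exists C n0, forall n, (n0 <= n)%N ->
    (18 * r ^ 2 * T n <= (r ^ 2 + 1) * n ^ 2 + C * n)%N) ->
  ((fun n : nat => (T n)%:R / (n%:R ^+ 2 / 18%:R) : R) @ \oo --> (1 : R))%classic.
Proof.
move=> lower upper; apply/cvgrPdist_le => e e0.
pose r := (Num.truncn (2 / e)).+1.
have r1 : 1 <= r%:R :> R by rewrite ler1n.
have re : 2 <= e * r%:R.
  by rewrite -ler_pdivrMl // mulrC ltW // /r truncnS_gt.
have [C [n0 hC]] := upper r isT.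
near=> n.
have n0n : (n0 <= n)%N by near: n; exact: nbhs_infty_ge.
have n1 : (0 < n)%N by near: n; exact: nbhs_infty_gt.
have nC : 2 * (C%:R + 1) / e <= n%:R.
  by near: n; exact: nbhs_infty_ger.
have {}nC : 2 * (C%:R + 1) <= e * n%:R by rewrite -ler_pdivrMl // mulrC.
have lo : n%:R ^+ 2 <= 18 * (T n)%:R + n%:R :> R.
  by rewrite -!natrX -natrM -natrD ler_nat.
have up : 18 * r%:R ^+ 2 * (T n)%:R <= (r%:R ^+ 2 + 1) * n%:R ^+ 2 + C%:R * n%:R :> R.
  rewrite -!natrX -!natrM -[X in _ <= (_ + X) * _ + _]/(1%:R) -natrD -!natrM -natrD ler_nat.
  exact: hC.
have x1 : 1 <= n%:R :> R by rewrite ler1n.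
have C0 : 0 <= C%:R :> R by [].
move: (n%:R : R) (r%:R : R) (C%:R : R) ((T n)%:R : R) r1 re nC lo up x1 C0.
move=> x rho c t r1 re nC lo up x1 c0.
have x0 : 0 < x ^+ 2 / 18 by rewrite divr_gt0 // exprn_gt0 //; lra.
rewrite distrC ler_norml lerBrDl ler_pdivlMr //.
have x2 : x <= x ^+ 2 * e by nra.
apply/andP; split; first by nra.
rewrite lerBlDl ler_pdivrMr //.
have r2 : 2 <= e * rho ^+ 2 by nra.
have key : x ^+ 2 + c * x <= e * rho ^+ 2 * x ^+ 2.
  have h1 : c * x <= x ^+ 2 * e / 2 by nra.
  have h2 : x ^+ 2 * e / 2 <= x ^+ 2 * (e * rho ^+ 2) / 2.
    by rewrite ler_pM2r // ler_wpM2l ?sqr_ge0 // ler_peMr ?exprn_ege1 ?(ltW e0).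
  have h3 : x ^+ 2 * 2 <= x ^+ 2 * (e * rho ^+ 2) by rewrite ler_wpM2l ?sqr_ge0.
  by lra.
have rho0 : 0 < rho ^+ 2 by rewrite exprn_gt0 //; lra.
rewrite -(ler_pM2l rho0); lra.
Unshelve. all: by end_near.
Qed.


Local Open Scope classical_set_scope.

Theorem theorem1p1 (R : realType) :
  (fun n : nat => (typical_rank R[i] n)%:R / (n%:R ^+ 2 / 18%:R) : R)
    @ \oo --> (1 : R).
Proof.
apply: ratio_cvg; first exact: typical_rank_lower.
exact: typical_rank_upper_eventually.
Qed.
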